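(* Let $Y_1,\dots,Y_n$ be an i.i.d. sample of copies of a real random variable $Y$ with mean $m$, variance $v$ and uniform kurtosis $c$. Choose positive real constants $x_i$ and confidence levels $\epsilon_i$, $i=1,\dots,2k$. Let $U_i$, $i=2,\dots,2k$, be uniform real random variables in the interval $(-1,+1)$, independent of each other and of everything else. Start with some prior guess $\theta_1$ for $m$. Put $\gamma_1=0$ and $\gamma_i=\sum_{j=2}^i\log(1+x_j^{-1})$ for $i=2,\dots,2k$, and for $i=1,\dots,k$ put $$\delta_{2i-1}=\sqrt{\frac{2[\log(\epsilon_{2i-1}^{-1})+\gamma_{2i-1}]}{(c-1)n}},\qquad \zeta_{2i-1}=-\frac12\log\Bigl\{1-h\bigl[\tfrac{c}{c-1},(c-1)\delta_{2i-1}\bigr]\Bigr\}.$$ (The quantities $\gamma_i$, $\delta_{2i-1}$ and $\zeta_{2i-1}$ are non random and known prior to observing the sample.) Define by induction, for $i=1,\dots,k$, $$\widetilde\theta_{2i-1}=\begin{cases}\theta_1,&i=1,\\ \widetilde\theta_{2i-2}+\zeta_{2i-2}\,x_{2i-1}U_{2i-1},&i\ge2,\end{cases}$$ $$\widetilde q_{2i-1}=\frac{\delta_{2i-1}\exp(-\zeta_{2i-1})}{Q^{-1}_{\widetilde\theta_{2i-1},\delta_{2i-1}}\bigl[-(c-1)\delta_{2i-1}^2\bigr]},\qquad \widetilde q_{2i}=\widetilde q_{2i-1}\exp(x_{2i}\zeta_{2i-1}U_{2i}),$$ $$\alpha_{2i}=\exp\Bigl[-\frac{(1+x_{2i})\zeta_{2i-1}}{2}\Bigr]\sqrt{\frac{2[\log(\epsilon_{2i}^{-1})+\gamma_{2i}]}{n\,\widetilde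 q_{2i}}},$$ $$\zeta_{2i}=\exp\Bigl[\frac{(1+x_{2i})\zeta_{2i-1}}{2}\Bigr]\sqrt{\frac{2\,\widetilde q_{2i}[\log(\epsilon_{2i}^{-1})+\gamma_{2i}]}{n}},\qquad \widetilde\theta_{2i}=\widehat\theta_{\alpha_{2i}}(\widetilde\theta_{2i-1}).$$ Assume that $$\max_{i=1,\dots,k}\delta_{2i-1}\le\frac{1}{2\sqrt{c(c-1)}-(c-1)}.$$ With probability at least $1-2\sum_{i=1}^{2k}\epsilon_i$, for any $i=1,\dots,k$, $$|m-\widetilde\theta_{2i}|\le\zeta_{2i},\qquad \bigl|\log(\widetilde q_{2i-1})-\log\bigl[v+(m-\widetilde\theta_{2i-1})^2\bigr]\bigr|\le\zeta_{2i-1}.$$ As a consequence, on the same event of probability at least $1-2\sum_{i=1}^{2k}\epsilon_i$, $$\zeta_2\le\exp[(1+x_2)\zeta_1]\sqrt{\frac{2[v+(m-\theta_1)^2][\log(\epsilon_2^{-1})+\gamma_2]}{n}},$$ and for any $i=2,\dots,k$, $$(m-\widetilde\theta_{2i-1})^2\le(1+x_{2i-1})^2\zeta_{2i-2}^2,$$ $$\widetilde q_{2i-1}\le\bigl[v+(1+x_{2i-1})^2\zeta_{2i-2}^2\bigr]\exp(\zeta_{2i-1}),$$ $$\zeta_{2i}\le\exp[(1+x_{2i})\zeta_{2i-1}]\sqrt{\frac{2\bigl[v+(1+x_{2i-1})^2\zeta_{2i-2}^2\bigr][\log(\epsilon_{2i}^{-1})+\gamma_{2i}]}{n}},$$ $$\exp(-\zeta_{2i-1})\widetilde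 q_{2i-1}-(1+x_{2i-1})^2\zeta_{2i-2}^2\le v\le\exp(\zeta_{2i-1})\widetilde q_{2i-1}.$$ These inequalities allow one to compute by induction a (non observable) deterministic bound for $\zeta_{2k}$, which is itself a random observable confidence interval half width for the estimate $\widetilde\theta_{2k}$ of the mean. The last one (better used with $i=k$) gives as a by-product an estimate of the variance with observable as well as theoretical confidence bounds.
   Context: The uniform kurtosis of $Y$ is $$c=\sup_{\theta\in\mathbb{R}}\frac{\mathbb{E}[(Y-\theta)^4]}{\mathbb{E}[(Y-\theta)^2]^2}.$$ For $\alpha>0$ and $\theta\in\mathbb{R}$, the thresholded estimator of the mean is $$\widehat\theta_\alpha(\theta)=\theta+\frac1{n\alpha}\sum_{i=1}^nT[\alpha(Y_i-\theta)],\qquad T(x)=\frac12\log\left(\frac{1+x+\frac{x^2}2}{1-x+\frac{x^2}2}\right).$$ For $\theta\in\mathbb{R}$ and $\delta\in(0,1]$, $Q_{\theta,\delta}^{-1}$ denotes the inverse of the increasing mapping $\alpha\in\mathbb{R}_+\mapsto Q_{\theta,\delta}(\alpha)$ defined by $$Q_{\theta,\delta}(\alpha)=\frac1n\sum_{i=1}^n\log\Bigl\{1+\alpha(Y_i-\theta)^2-\delta+\tfrac12\bigl[\alpha(Y_i-\theta)^2-\delta\bigr]^2\Bigr\}.$$ The ancillary function $h$ is $$h(a,y)=\frac{4y}{(1+y)\Bigl\{1+\sqrt{1-\frac{4ay^2}{(1+y)^2}}\Bigr\}}.$$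
   Formalization: The formal statement adds that h[c/(c-1),(c-1)δ_{2i-1}] < 1 for i=1..k, so that the logarithm defining ζ_{2i-1} exists (the stated bound on δ does not ensure it: c=3, δ=0.3 gives h>1); it also takes v>0 and ε_i<1. *)

(* Defs.v *)
From HB Require Import structures.
From mathcomp Require Import all_boot all_order all_algebra.
From mathcomp Require Import all_classical all_reals all_analysis.

Set Implicit Arguments.
Unset Strict Implicit.
Unset Printing Implicit Defensive.
Import Order.TTheory GRing.Theory Num.Theory.
Import numFieldNormedType.Exports.
Local Open Scope classical_set_scope.
Local Open Scope ring_scope.

Lemma ltrN11 (R : realType) : -1 < 1 :> R.
Proof. exact: lt_trans (ltrN10 R) ltr01. Qed.

Section Probability.
Context d (T : measurableType d) (R : realType) (P : probability T R).

(* [0 / 0 = 0] and [+oo / +oo = 0] in [\bar R]; when the variance of Y is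
   positive and finite, the denominator is positive and finite for every theta,
   and a finite supremum forces a finite fourth moment. *)
Definition uniform_kurtosis (Y : T -> R) : \bar R :=
  ereal_sup (range (fun theta : R =>
    ('E_P[fun w => ((Y w - theta) ^+ 4)%R] /
     'E_P[fun w => ((Y w - theta) ^+ 2)%R] ^+ 2)%E)).

Definition identically_distributed (X Y : {RV P >-> R}) : Prop :=
  forall A : set R, measurable A -> distribution P X A = distribution P Y A.

Definition uniformly_distributed (a b : R) (ab : a < b) (X : {RV P >-> R}) :
    Prop :=
  forall A : set R, measurable A -> distribution P X A = uniform_prob ab A.

Definition mutually_independent (I : finType) (X : I -> {RV P >-> R}) : Prop :=
  forall (J : {set I}) (A : I -> set R),
    (forall i, i \in J -> measurable (A i)) ->
    P (\bigcap_(i in [set` J]) (X i @^-1` A i)) =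
    (\prod_(i in J) P (X i @^-1` A i))%E.

(* The family made of the sample Y_1, ..., Y_n and of U_2, ..., U_2k. *)
Definition sample_and_uniforms (n k : nat) (Ys : 'I_n -> {RV P >-> R})
    (U : nat -> {RV P >-> R}) (s : ('I_n + 'I_(2 * k).-1)%type) : {RV P >-> R} :=
  match s with
  | inl j => Ys j
  | inr j => U j.+2
  end.

End Probability.

Section Estimators.
Context (R : realType).

Definition soft_threshold (x : R) : R :=
  2^-1 * ln ((1 + x + x ^+ 2 / 2) / (1 - x + x ^+ 2 / 2)).

Definition hfun (a y : R) : R :=
  4 * y / ((1 + y) * (1 + Num.sqrt (1 - 4 * a * y ^+ 2 / (1 + y) ^+ 2))).

Context (n : nat).

Definition theta_hat (y : 'I_n -> R) (alpha theta : R) : R :=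
  theta + (n%:R * alpha)^-1 *
          \sum_(i < n) soft_threshold (alpha * (y i - theta)).

Definition Qfun (y : 'I_n -> R) (theta delta alpha : R) : R :=
  n%:R^-1 * \sum_(i < n)
    ln (1 + (alpha * (y i - theta) ^+ 2 - delta) +
        2^-1 * (alpha * (y i - theta) ^+ 2 - delta) ^+ 2).

(* Inverse of [Qfun y theta delta] on [0, +oo[; the default value is 0 outside
   of its range, and the choice of a preimage only matters when all the
   [y i] are equal to theta, in which case Q is constant. *)
Definition Qinv (y : 'I_n -> R) (theta delta z : R) : R :=
  xget 0 [set alpha : R | 0 <= alpha /\ Qfun y theta delta alpha = z].

(* c is the uniform kurtosis, x_i and eps_i are indexed by 1 <= i <= 2k. *)
Context (c : R) (x eps : nat -> R).

Definition gamma_sum (i : nat) : R := \sum_(2 <= j < i.+1) ln (1 + (x j)^-1).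

Definition level (i : nat) : R := ln ((eps i)^-1) + gamma_sum i.

(* [delta i] and [zeta_odd i] are meant for odd i. *)
Definition delta (i : nat) : R :=
  Num.sqrt (2 * level i / ((c - 1) * n%:R)).

Definition zeta_odd (i : nat) : R :=
  - (2^-1 * ln (1 - hfun (c / (c - 1)) ((c - 1) * delta i))).

(* [stage i] gathers (theta_i, q_i, zeta_i); the stage of index i only depends
   on the one of index i - 1. *)
Record stage_data := Stage { st_theta : R; st_q : R; st_zeta : R }.

Definition odd_stage (y : 'I_n -> R) (i : nat) (theta : R) : stage_data :=
  Stage theta
    (delta i * expR (- zeta_odd i) /
     Qinv y theta (delta i) (- ((c - 1) * delta i ^+ 2)))
    (zeta_odd i).

(* For even i, from the previous (odd) stage s and the value ui of U_i. *)
Definition even_stage (y : 'I_n -> R) (ui : R) (i : nat) (s : stage_data) :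
    stage_data :=
  let q := st_q s * expR (x i * st_zeta s * ui) in
  let alpha := expR (- ((1 + x i) * st_zeta s / 2)) *
               Num.sqrt (2 * level i / (n%:R * q)) in
  let zeta := expR ((1 + x i) * st_zeta s / 2) *
              Num.sqrt (2 * q * level i / n%:R) in
  Stage (theta_hat y alpha (st_theta s)) q zeta.

(* y and u are the values of the sample and of the U_i; index 0 is not used. *)
Fixpoint stage (theta1 : R) (y : 'I_n -> R) (u : nat -> R) (i : nat) :
    stage_data :=
  match i with
  | 0 => Stage theta1 0 0
  | 1 => odd_stage y 1 theta1
  | j.+1 =>
    let s := stage theta1 y u j in
    if odd j.+1
    then odd_stage y j.+1 (st_theta s + st_zeta s * x j.+1 * u j.+1)
    else even_stage y (u j.+1) j.+1 s
  end.

(* Deterministic bound for zeta_2i, obtained by iterating the bounds of zeta_2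
   and of zeta_2i in terms of zeta_(2i-2). *)
Fixpoint zeta_bound (m v theta1 : R) (i : nat) : R :=
  match i with
  | 0 => 0
  | 1 => expR ((1 + x 2) * zeta_odd 1) *
         Num.sqrt (2 * (v + (m - theta1) ^+ 2) * level 2 / n%:R)
  | j.+1 =>
    expR ((1 + x (2 * j.+1)) * zeta_odd (2 * j.+1).-1) *
    Num.sqrt (2 * (v + (1 + x (2 * j.+1).-1) ^+ 2 *
                       zeta_bound m v theta1 j ^+ 2) *
              level (2 * j.+1) / n%:R)
  end.

End Estimators.

(* Main.v *)
From HB Require Import structures.
Require Import Defs.
From mathcomp Require Import all_boot all_order all_algebra.
From mathcomp Require Import all_classical all_reals all_analysis.
From mathcomp Require Import measurable_realfun.
From mathcomp Require Import zify ring lra.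

Set Implicit Arguments.
Unset Strict Implicit.
Unset Printing Implicit Defensive.
Import Order.TTheory GRing.Theory Num.Theory.
Import numFieldNormedType.Exports.
Local Open Scope classical_set_scope.
Local Open Scope ring_scope.

(** The proof rests on three ideas.

    _Deviations at a fixed parameter._ Both $T$ and $Q_{\theta,\delta}$ are built from
    the logarithm of $1 + x + x^2/2$. The mean of that polynomial in a random variable
    is at most the exponential of its first moment plus half its second moment, so
    that Chernoff bounds ([sample_chernoff]) only require second moments of
    $\pm\alpha(Y-\theta)$ or of $\pm(\alpha(Y-\theta)^2-\delta)$; the latter are
    controlled by the uniform kurtosis. The lower tail reduces to the upper one
    because $(1+x+x^2/2)(1-x+x^2/2) \ge 1$. For a deterministic $\theta$ with
    $\mu = v + (m-\theta)^2$ this gives [Qfun_tail] and [theta_hat_tail]. At the points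
    $\delta(1-h)/\mu$ and $\delta/\mu$ the confidence curves of $Q_{\theta,\delta}$ cross
    the level $-(c-1)\delta^2$ ([odd_h_root]); hence the inverse lies between these
    points, and $\widetilde q$ is within a factor $e^{\pm\zeta}$ of $\mu$
    ([ratio_log_bound]). The uniform kurtosis is at least 2 ([uniform_kurtosis_ge2]),
    which makes $\delta \le 1$ and $Q_{\theta,\delta}$ increasing.

    _Change of measure._ The parameters of the later stages depend on the sample. But
    each one is uniform on an interval, on a linear or a logarithmic scale, whose
    centre is, as long as no earlier stage failed, at distance at most $\zeta$ from a
    centre that does not depend on the sample, namely $m$ or $\log\mu$. Its density is
    therefore at most $1+1/x$ times that of the uniform law on an interval around that
    deterministic centre ([integral_uniform_widen], [data_step_widen]). Iterating,
    the probability that stage $i$ is the first one to fail is at most $e^{\gamma_i}$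
    times a bound valid for deterministic parameters ([transfer], [failure_le]), and
    the terms $\gamma_i$ in the confidence levels are there to compensate for this
    factor ([prod_ratio_level]). The variables $U_i$ are integrated out one at a time
    by Tonelli's theorem, given the $\sigma$-algebra of the sample and of the earlier
    ones ([indep_tonelli]).

    _Propagation._ Outside the union of these failures everything is deterministic:
    $\theta$ moves by at most $x\zeta$ and $\log q$ by at most $x\zeta$, and the stated
    inequalities follow by monotonicity ([good_path_bounds]). *)

(** * Logarithms of the truncated exponential *)

Section QuadraticLog.
Context (R : realType).
Implicit Types x y : R.

(** The second-order truncation of the exponential. Unlike the exponential series
    at first order it is positive everywhere, and its mean only involves two
    moments; the truncation $T$ and the function $Q_{\theta,\delta}$ are both built
    from its logarithm. *)
Definition quad x : R := 1 + x + x ^+ 2 / 2.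

Lemma quad_gt0 x : 0 < quad x.
Proof. by rewrite /quad; nra. Qed.

(** The parabola is centred at $-1$. *)
Lemma quad_lt x y : -1 <= x -> x < y -> quad x < quad y.
Proof. by rewrite /quad => ? ?; nra. Qed.

Lemma continuous_quad : continuous quad.
Proof.
move=> x; apply: (@continuousD _ R^o R^o).
  by apply: (@continuousD _ R^o R^o); [exact: cst_continuous|move=> ?; exact: cvg_id].
apply: cvgMr_tmp; exact: exprn_continuous.
Qed.

Lemma quad_mulN_ge1 x : 1 <= quad x * quad (- x).
Proof. by rewrite /quad; nra. Qed.

(** Since the product of the two values is $1 + x^4/4$, a lower deviation of a sum
    of terms $\log$ [quad] can be treated as an upper deviation of the sum with
    opposite arguments. *)
Lemma ln_quadN x : - ln (quad x) <= ln (quad (- x)).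
Proof.
rewrite -lnV ?posrE ?quad_gt0// ler_ln ?posrE ?invr_gt0 ?quad_gt0//.
by rewrite -[_^-1]mul1r ler_pdivrMr ?quad_gt0// mulrC quad_mulN_ge1.
Qed.

Lemma soft_thresholdE x :
  soft_threshold x = 2^-1 * (ln (quad x) - ln (quad (- x))).
Proof.
rewrite /soft_threshold -ln_div ?posrE ?quad_gt0//.
by rewrite /quad sqrrN.
Qed.

Lemma soft_threshold_le x : soft_threshold x <= ln (quad x).
Proof.
have := ln_quadN (- x); rewrite opprK soft_thresholdE; lra.
Qed.

Lemma soft_threshold_ge x : - soft_threshold x <= ln (quad (- x)).
Proof. have := ln_quadN x; rewrite soft_thresholdE; lra. Qed.

End QuadraticLog.

(** * The inverse of $Q_{\theta,\delta}$ *)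

Section Quantile.
Context (R : realType) (n : nat) (hn : (0 < n)%N).
Implicit Types (y : 'I_n -> R) (theta delta alpha z : R).

Lemma QfunE y theta delta alpha : Qfun y theta delta alpha =
  n%:R^-1 * \sum_(i < n) ln (quad (alpha * (y i - theta) ^+ 2 - delta)).
Proof.
by rewrite /Qfun; congr (_ * _); apply: eq_bigr => i _; rewrite [2^-1 * _]mulrC.
Qed.

Lemma Qfun_continuous y theta delta : continuous (Qfun y theta delta).
Proof.
move=> a; rewrite [X in continuous_at _ X](_ : _ = fun alpha => n%:R^-1 *
  \sum_(i < n) ln (quad (alpha * (y i - theta) ^+ 2 - delta))); last first.
  by apply/funext => alpha; rewrite QfunE.
apply: cvgMl_tmp.
apply: cvg_big => [|i _]; first exact: (@add_continuous R^o).
have cX : {for (a : R), continuous (fun t : R => t * (y i - theta) ^+ 2 - delta)}.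
  apply: (@cvgB _ R^o); last exact: cvg_cst.
  by apply: cvgMr_tmp; exact: cvg_id.
exact: (continuous_comp (continuous_comp cX (@continuous_quad _ _))
  (continuous_ln (quad_gt0 _))).
Qed.

(** The condition $\delta \le 1$ keeps the arguments of [quad] in the region where
    it increases. *)
Lemma Qfun_lt y theta delta a b : delta <= 1 ->
  (exists i, y i != theta) -> 0 <= a -> a < b ->
  Qfun y theta delta a < Qfun y theta delta b.
Proof.
move=> d1 [i0 yi0] a0 ab; rewrite !QfunE ltr_pM2l ?invr_gt0 ?ltr0n//.
have le_arg i : a * (y i - theta) ^+ 2 - delta <= b * (y i - theta) ^+ 2 - delta.
  by rewrite lerB// ler_wpM2r ?sqr_ge0// ltW.
have ge_arg i : -1 <= a * (y i - theta) ^+ 2 - delta.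
  by have := mulr_ge0 a0 (sqr_ge0 (y i - theta)); lra.
rewrite (bigD1 i0)//= [ltRHS](bigD1 i0)//=; apply: ltr_leD.
  rewrite ltr_ln ?posrE ?quad_gt0//; apply: quad_lt => //.
  by rewrite ltrD2r ltr_pM2r// exprn_even_gt0//= subr_eq0.
apply: ler_sum => i _; rewrite ler_ln ?posrE ?quad_gt0//.
have := le_arg i; rewrite le_eqVlt => /orP[/eqP->//|lt_arg].
by rewrite ltW// quad_lt.
Qed.

Lemma Qfun_const y theta delta a b : (forall i, y i = theta) ->
  Qfun y theta delta a = Qfun y theta delta b.
Proof.
move=> yt; rewrite !QfunE; congr (_ * _); apply: eq_bigr => i _.
by rewrite yt subrr expr0n/= !mulr0.
Qed.

Lemma Qfun_le y theta delta a b : delta <= 1 -> 0 <= a -> a <= b ->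
  Qfun y theta delta a <= Qfun y theta delta b.
Proof.
move=> d1 a0; rewrite le_eqVlt => /orP[/eqP->//|ab].
have [nc|/forallNP yt] := pselect (exists i, y i != theta).
  exact/ltW/Qfun_lt.
rewrite (Qfun_const _ a b)// => i; apply/eqP.
by move: (yt i) => /negP; rewrite negbK.
Qed.

Lemma Qfun_lt_arg y theta delta a b : delta <= 1 -> 0 <= b ->
  Qfun y theta delta a < Qfun y theta delta b -> a < b.
Proof. by move=> d1 b0; rewrite !ltNge; apply: contraNN; exact: Qfun_le. Qed.

Lemma Qinv_solution y theta delta z a b : 0 <= a -> a <= b ->
  Qfun y theta delta a <= z -> z <= Qfun y theta delta b ->
  0 <= Qinv y theta delta z /\ Qfun y theta delta (Qinv y theta delta z) = z.
Proof.
move=> a0 ab Qa Qb.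
have [c cab Qc] : exists2 c, c \in `[a, b]%R & Qfun y theta delta c = z.
  apply: IVT => //; first exact/continuous_subspaceT/Qfun_continuous.
  by have := le_trans Qa Qb => Qab; rewrite min_l// max_r// Qa.
rewrite /Qinv; apply: (@xgetI _ 0 [set alpha | 0 <= alpha /\ _] c) => /=.
by split => //; move: cab; rewrite in_itv/= => /andP[/(le_trans a0)].
Qed.

(** With strict inequalities the function is not constant in $\alpha$, so that the
    inverse is unambiguous. *)
Lemma Qinv_bracket y theta delta z a b : delta <= 1 -> 0 <= a -> a <= b ->
  Qfun y theta delta a < z -> z < Qfun y theta delta b ->
  a < Qinv y theta delta z < b.
Proof.
move=> d1 a0 ab Qa Qb.
have [q0 Qq] := Qinv_solution a0 ab (ltW Qa) (ltW Qb).
apply/andP; split; apply: (Qfun_lt_arg (y := y) (theta := theta) d1) => //.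
- by rewrite Qq.
- exact: le_trans ab.
- by rewrite Qq.
Qed.

End Quantile.

(** * The constants of the odd stages *)

Section OddStageConstants.
Context (R : realType) (c del : R).
Hypotheses (c2 : 2 <= c) (del0 : 0 < del)
  (del_le : del <= (2 * Num.sqrt (c * (c - 1)) - (c - 1))^-1).

Let h := hfun (c / (c - 1)) ((c - 1) * del).
Let D := 1 - 4 * (c / (c - 1)) * ((c - 1) * del) ^+ 2 / (1 + (c - 1) * del) ^+ 2.

Let c1_neq0 : c - 1 != 0. Proof. by rewrite gt_eqF//; move: c2; lra. Qed.

Let u_neq0 : 1 + (c - 1) * del != 0.
Proof. by rewrite gt_eqF//; move: c2 del0; nra. Qed.

Let sqrt_cc1 : c - 1 < Num.sqrt (c * (c - 1)).
Proof.
have s2 : Num.sqrt (c * (c - 1)) ^+ 2 = c * (c - 1).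
  by rewrite sqr_sqrtr// mulr_ge0//; move: c2; lra.
rewrite -[ltRHS]ger0_norm ?sqrtr_ge0// -[ltLHS]ger0_norm; last by move: c2; lra.
by rewrite -ltr_sqr ?nnegrE// ?normr_ge0// !real_normK ?num_real// s2; move: c2; nra.
Qed.

Let del_le1' : del * (2 * Num.sqrt (c * (c - 1)) - (c - 1)) <= 1.
Proof.
rewrite -ler_pdivlMr ?mul1r//; have := sqrt_cc1; move: c2; lra.
Qed.

Lemma odd_delta_le1 : del <= 1.
Proof.
by have := del_le1'; have := sqrt_cc1; move: c2 del0; set s := Num.sqrt _ => *; nra.
Qed.

(* This is where the upper bound on delta comes from. *)
Let radicand_ge0 : 0 <= D.
Proof.
have s2 : Num.sqrt (c * (c - 1)) ^+ 2 = c * (c - 1).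
  by rewrite sqr_sqrtr// mulr_ge0//; move: c2; lra.
have s0 := sqrtr_ge0 (c * (c - 1)).
have -> : D = ((1 + (c - 1) * del) ^+ 2 -
    (2 * Num.sqrt (c * (c - 1)) * del) ^+ 2) / (1 + (c - 1) * del) ^+ 2.
  rewrite [(2 * _ * _) ^+ 2]exprMn [(2 * _) ^+ 2]exprMn s2 /D; field.
  by rewrite c1_neq0 u_neq0.
apply: divr_ge0; last exact: sqr_ge0.
rewrite subr_ge0 ler_sqr ?nnegrE.
- by have := del_le1'; lra.
- by rewrite !mulr_ge0// ltW.
- by move: c2 del0 => *; nra.
Qed.

Let A := (1 + (c - 1) * del) * (1 + Num.sqrt D).

Let A_gt0 : 0 < A.
Proof. by rewrite /A mulr_gt0//; have := sqrtr_ge0 D; move: c2 del0; nra. Qed.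

Let A_root : A ^+ 2 - 2 * (1 + (c - 1) * del) * A + 4 * c * (c - 1) * del ^+ 2 = 0.
Proof.
have -> : A ^+ 2 - 2 * (1 + (c - 1) * del) * A + 4 * c * (c - 1) * del ^+ 2 =
  (1 + (c - 1) * del) ^+ 2 * (Num.sqrt D ^+ 2 - 1) + 4 * c * (c - 1) * del ^+ 2.
  by rewrite /A; ring.
rewrite sqr_sqrtr ?radicand_ge0// /D; field.
by rewrite c1_neq0 u_neq0.
Qed.

Let hE : h = 4 * ((c - 1) * del) / A. Proof. by []. Qed.

Lemma odd_h_gt0 : 0 < h.
Proof. by rewrite hE divr_gt0//; move: c2 del0; nra. Qed.

(** The number $1 - h$ is chosen so that $t = \delta (1 - h)$ is the larger root
    of the quadratic equation that equates the upper confidence curve of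
    $Q_{\theta,\delta}$ to the level $-(c-1)\delta^2$ at which it is inverted. *)
Lemma odd_h_root : let t := del * (1 - h) in
  (t - del) + ((t - del) ^+ 2 + (c - 1) * t ^+ 2) / 2 + (c - 1) * del ^+ 2 / 2 =
  - ((c - 1) * del ^+ 2).
Proof.
apply/eqP; rewrite -subr_eq0 hE; apply/eqP.
have A0 : A != 0 by rewrite gt_eqF.
transitivity (2 * (c - 1) * del ^+ 2 / A ^+ 2 *
   (A ^+ 2 - 2 * (1 + (c - 1) * del) * A + 4 * c * (c - 1) * del ^+ 2)).
  by field.
by rewrite A_root mulr0.
Qed.

End OddStageConstants.

(** If the inverse is taken between $\delta(1-h)/\mu$ and $\delta/\mu$, then dividing
    $\delta$ by it gives $\mu$ up to a factor in $[1, (1-h)^{-1}]$, which the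
    factor $e^{-\zeta}=(1-h)^{1/2}$ makes symmetric on the logarithmic scale. *)
Lemma ratio_log_bound (R : realType) (del h mu b : R) :
  0 < del -> 0 < h -> h < 1 -> 0 < mu ->
  del * (1 - h) / mu < b < del / mu ->
  let zeta := - (2^-1 * ln (1 - h)) in
  0 < del * expR (- zeta) / b /\
  `|ln (del * expR (- zeta) / b) - ln mu| <= zeta.
Proof.
move=> del0 h0 h1 mu0 /andP[lb ub] zeta.
have h1' : 0 < 1 - h by lra.
have b0 : 0 < b by rewrite (lt_trans _ lb)// divr_gt0// mulr_gt0.
split; first by rewrite divr_gt0// mulr_gt0// expR_gt0.
rewrite ln_div ?posrE ?mulr_gt0 ?expR_gt0// lnM ?posrE ?expR_gt0// expRK.
have : ln (del * (1 - h) / mu) <= ln b.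
  by rewrite ler_ln ?posrE ?divr_gt0 ?mulr_gt0// ltW.
rewrite ln_div ?posrE ?mulr_gt0// lnM ?posrE//.
have : ln b <= ln (del / mu) by rewrite ler_ln ?posrE ?divr_gt0// ltW.
by rewrite ln_div ?posrE// ler_norml /zeta => ? ?; apply/andP; split; lra.
Qed.

(** * Independence and iterated integration *)

Section Independence.
Context d (T : measurableType d) (R : realType) (P : probability T R).
Context (I : finType) (X : I -> {RV P >-> R}) (hX : mutually_independent X).
Implicit Types (J : {set I}) (s : I) (A : I -> set R) (B : set R).

(** A $\pi$-system generating the $\sigma$-algebra of the variables indexed by [J]. *)
Definition cylinders J : set (set T) :=
  [set C | exists2 A : I -> set R, (forall i, measurable (A i)) &
     C = \bigcap_(i in [set` J]) (X i @^-1` A i)].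

Lemma measurable_cylinders J : cylinders J `<=` measurable.
Proof.
move=> _ [A mA ->]; apply: fin_bigcap_measurable; first exact: finite_finset.
by move=> i _; exact: measurable_funPTI.
Qed.

Lemma setI_closed_cylinders J : setI_closed (cylinders J).
Proof.
move=> _ _ [A mA ->] [B mB ->]; exists (fun i => A i `&` B i).
  by move=> i; exact: measurableI.
by rewrite -bigcapI; apply: eq_bigcapr => i _; rewrite preimage_setI.
Qed.

Lemma cylinders_setT J : cylinders J setT.
Proof.
exists (fun=> setT) => //; apply/esym; rewrite -subTset => w _ i _; exact: Logic.I.
Qed.

Lemma cylinder_indep J s : s \notin J -> forall C B,
  cylinders J C -> measurable B -> P (C `&` X s @^-1` B) = (P C * P (X s @^-1` B))%E.
Proof.
move=> sJ _ B [A mA ->] mB; pose A' i := if i == s then B else A i.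
have AA' i : i \in J -> A' i = A i.
  by rewrite /A'; case: eqP => // -> sJ'; rewrite sJ' in sJ.
have mA' i : i \in J -> measurable (A' i) by move=> /AA' ->.
have mA's i : i \in s |: J -> measurable (A' i).
  by move=> _; rewrite /A'; case: ifP.
have := hX mA's; rewrite (big_setU1 _ sJ)/=.
have -> : \bigcap_(i in [set` s |: J]) (X i @^-1` A' i) =
    X s @^-1` B `&` \bigcap_(i in [set` J]) (X i @^-1` A i).
  apply/seteqP; split=> w.
    move=> h; split.
      by have := h s; rewrite /= setU11 /A' eqxx; exact.
    by move=> i iJ; have := h i; rewrite /= setU1r// AA'//; exact.
  move=> [hs hJ] i /=; rewrite !inE => /orP[/eqP->|iJ].
    by rewrite /A' eqxx.
  by rewrite AA'//; exact: hJ.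
rewrite setIC => ->; rewrite {1}/A' eqxx muleC; congr (_ * _)%E.
rewrite -(hX mA'); congr (P _); apply: eq_bigcapr => i iJ.
by rewrite AA'.
Qed.

(** Two finite measures that agree on a $\pi$-system agree on the $\sigma$-algebra it
    generates. *)
Lemma g_sigma_cylinders_indep J s : s \notin J -> forall C B,
  <<s cylinders J >> C -> measurable B ->
  P (C `&` X s @^-1` B) = (P C * P (X s @^-1` B))%E.
Proof.
move=> sJ C B sC mB.
have mXB : measurable (X s @^-1` B) by exact: measurable_funPTI.
have [p p0 pE] : exists2 p : R, 0 <= p & P (X s @^-1` B) = p%:E.
  exists (fine (P (X s @^-1` B))); first by rewrite fine_ge0.
  by rewrite fineK// fin_num_measure.
transitivity (mrestr P mXB C) => //.
rewrite (@g_sigma_algebra_measure_unique _ _ T (cylinders J)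
  (@measurable_cylinders J) (fun=> setT) (fun=> cylinders_setT J) _
  (mrestr P mXB) (mscale (NngNum p0) P) (@setI_closed_cylinders J) _ _ C sC).
- by rewrite /mscale/= muleC pE.
- by rewrite bigcup_const.
- move=> D hD; rewrite -[LHS]/(P (D `&` X s @^-1` B)) (cylinder_indep sJ)//.
  by rewrite /mscale/= muleC pE.
- move=> _; rewrite -[ltLHS]/(P (setT `&` X s @^-1` B)) setTI.
  by rewrite (le_lt_trans (probability_le1 _ _)) ?ltry.
Qed.

(** The sample space with the coarser $\sigma$-algebra: a function that is measurable
    on it depends on the outcome only through the variables indexed by [J]. *)
Definition cyl_space J : measurableType _ := g_sigma_algebraType (cylinders J).

Lemma measurable_cylinders_fun J s : s \in J ->
  measurable_fun [set: cyl_space J] (X s : _ -> R).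
Proof.
move=> sJ _ B mB; rewrite setTI; apply: sub_sigma_algebra.
exists (fun i => if i == s then B else setT); first by move=> i; case: ifP.
apply/seteqP; split=> [w Bw i iJ|w]; first by case: eqP => // ->.
by move/(_ s sJ); rewrite /= eqxx.
Qed.

Lemma measurable_cyl_id J : measurable_fun [set: T] (id : T -> cyl_space J).
Proof.
move=> _ B mB; rewrite setTI; apply: smallest_sub mB.
  exact: sigma_algebra_measurable.
exact: measurable_cylinders.
Qed.

(** The identity, seen as a map to [cyl_space J], and [X s] have a product measure as
    joint law, to which Tonelli's theorem applies. Keeping the outcome itself as
    first coordinate allows an integrand that is not a function of a vector of the
    $X_j$ given in advance. *)
Lemma indep_tonelli J s (sJ : s \notin J)
    (h : cyl_space J * R -> \bar R) :
  measurable_fun setT h -> (forall z, (0 <= h z)%E) ->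
  (\int[P]_w h (w, X s w) = \int[P]_w \int[distribution P (X s)]_u h (w, u))%E.
Proof.
move=> mh h0.
pose O := cyl_space J.
have mid := @measurable_cyl_id J.
have mpair : measurable_fun [set: T] (fun w => (w : O, X s w)).
  exact: measurable_fun_pair.
pose idO : {mfun T >-> O} := HB.pack (id : T -> O)
  (isMeasurableFun.Build _ _ _ _ _ mid).
pose pairX : {mfun T >-> (O * R)%type} := HB.pack (fun w => (w : O, X s w))
  (isMeasurableFun.Build _ _ _ _ _ mpair).
transitivity (\int[distribution P pairX]_z h z)%E.
  by rewrite ge0_integral_pushforward.
transitivity (\int[distribution P idO \x distribution P (X s)]_z h z)%E.
  apply: eq_measure_integral => C mC _; apply/esym/product_measure_unique => // A B mA mB.
  exact: (g_sigma_cylinders_indep sJ mA mB).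
rewrite fubini_tonelli1// ge0_integral_pushforward//.
  exact: measurable_fun_fubini_tonelli_F.
by move=> w _; apply: integral_ge0.
Qed.

End Independence.

(** * Moments under a finite uniform kurtosis *)

Section Mean.
Context d (T : measurableType d) (R : realType) (P : probability T R).
Implicit Types f g : T -> R.

(** Integrability and the value of the integral together, so that means of
    polynomials of a variable are obtained by pure algebra. *)
Definition has_mean f (e : R) :=
  P.-integrable setT (EFin \o f) /\ (\int[P]_w (f w)%:E = e%:E)%E.

Lemma eq_has_mean f g e e' : f =1 g -> e = e' -> has_mean f e -> has_mean g e'.
Proof. by move=> /funext -> ->. Qed.

Lemma has_mean_cst k : has_mean (cst k) k.
Proof.
split; first exact: finite_measure_integrable_cst.
by rewrite (integral_cst P measurableT k%:E)/= probability_setT mule1.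
Qed.

Lemma has_meanD f g a b : has_mean f a -> has_mean g b ->
  has_mean (fun w => f w + g w) (a + b).
Proof.
move=> [if_ ef] [ig eg]; split; first exact: (integrableD _ if_ ig).
by under eq_integral do rewrite EFinD; rewrite integralD// ef eg.
Qed.

Lemma has_meanZ k f a : has_mean f a -> has_mean (fun w => k * f w) (k * a).
Proof.
move=> [if_ ef]; split; first exact: (integrableZl _ k if_).
by under eq_integral do rewrite EFinM; rewrite integralZl// ef.
Qed.

Lemma has_mean_le f g a b : has_mean f a -> has_mean g b ->
  (forall w, f w <= g w) -> a <= b.
Proof.
move=> [if_ ef] [ig eg] fg; rewrite -lee_fin -ef -eg.
by apply: le_integral => // w _; rewrite lee_fin.
Qed.

Lemma has_mean_ge0 f a : measurable_fun setT f -> (forall w, 0 <= f w) ->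
  (\int[P]_w (f w)%:E = a%:E)%E -> has_mean f a.
Proof.
move=> mf f0 ef; split => //; apply/integrableP; split; first exact/measurable_EFinP.
rewrite (eq_integral (EFin \o f)) ?ef ?ltry// => w _ /=.
by rewrite ger0_norm.
Qed.

Lemma has_mean_dominated f g b : measurable_fun setT f -> has_mean g b ->
  (forall w, `|f w| <= g w) -> exists a, has_mean f a.
Proof.
move=> mf [ig _] fg.
have if_ : P.-integrable setT (EFin \o f).
  apply: le_integrable ig => //; first exact/measurable_EFinP.
  by move=> w _; rewrite /= lee_fin (le_trans (fg w))// ler_norm.
by exists (fine (\int[P]_w (f w)%:E)%E); split => //; rewrite fineK// integrable_fin_num.
Qed.

End Mean.

Section Moments.
Context d (T : measurableType d) (R : realType) (P : probability T R).
Context (Y : {RV P >-> R}) (m v c : R).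
Context (hm : ('E_P[Y] = m%:E)%E) (hv : ('V_P[Y] = v%:E)%E) (hv0 : 0 < v)
  (hc : uniform_kurtosis P Y = c%:E).

Let mY : measurable_fun setT (Y : T -> R). Proof. exact: measurable_funPT. Qed.

Let mYX theta n : measurable_fun setT (fun w => (Y w - theta) ^+ n).
Proof. by apply: measurable_funX; apply: measurable_funB. Qed.

Let centered2 : has_mean P (fun w => (Y w - m) ^+ 2) v.
Proof.
apply: has_mean_ge0 => //; first by move=> w; exact: sqr_ge0.
by rewrite -hv /variance unlock hm /= unlock.
Qed.

Let mean1 : has_mean P Y m.
Proof.
have dom := has_meanD centered2 (has_mean_cst P (1 + `|m|)).
have [w|a ha] := has_mean_dominated mY dom.
  have : `|Y w - m| <= (Y w - m) ^+ 2 + 1.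
    by rewrite -[_ ^+ 2]real_normK ?num_real//; have := normr_ge0 (Y w - m); nra.
  by have := ler_normD (Y w - m) m; rewrite subrK /=; lra.
suff -> : m = a by [].
by apply: EFin_inj; rewrite -hm -ha.2 unlock.
Qed.

Definition second_moment theta := v + (m - theta) ^+ 2.

Lemma second_moment_gt0 theta : 0 < second_moment theta.
Proof. by rewrite /second_moment ltr_wpDr ?sqr_ge0. Qed.

Lemma has_mean1 theta : has_mean P (fun w => Y w - theta) (m - theta).
Proof. exact: (has_meanD mean1 (has_mean_cst _ (- theta))). Qed.

Lemma has_mean2 theta : has_mean P (fun w => (Y w - theta) ^+ 2) (second_moment theta).
Proof.
have := has_meanD centered2 (has_meanD (has_meanZ (2 * (m - theta)) mean1)
  (has_mean_cst _ (theta ^+ 2 - m ^+ 2))).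
by apply: eq_has_mean => [w|]; rewrite /second_moment /=; ring.
Qed.

(** The quotient that defines the kurtosis would be infinite if the fourth moment
    were. *)
Lemma has_mean4 theta : exists2 M, has_mean P (fun w => (Y w - theta) ^+ 4) M &
  M <= c * second_moment theta ^+ 2.
Proof.
have mu0 := second_moment_gt0 theta.
have : ('E_P[fun w => ((Y w - theta) ^+ 4)%R] /
    'E_P[fun w => ((Y w - theta) ^+ 2)%R] ^+ 2 <= c%:E)%E.
  by rewrite -hc; apply: ereal_sup_ubound; exists theta.
have -> : ('E_P[fun w => ((Y w - theta) ^+ 2)%R] = (second_moment theta)%:E)%E.
  by rewrite unlock (has_mean2 theta).2.
rewrite -EFin_expe inver gt_eqF ?exprn_gt0// lee_pdivrMr ?exprn_gt0// -EFinM.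
rewrite unlock => h.
have fin : (\int[P]_w ((Y w - theta) ^+ 4)%:E)%E \is a fin_num.
  rewrite ge0_fin_numE ?(le_lt_trans h) ?ltry//.
  by apply: integral_ge0 => w _; rewrite lee_fin exprn_even_ge0.
exists (fine (\int[P]_w ((Y w - theta) ^+ 4)%:E)).
  by apply: has_mean_ge0 => [//|w|]; rewrite ?exprn_even_ge0 ?fineK.
by rewrite -lee_fin fineK.
Qed.

(** Two prior guesses at distance one standard deviation on both sides of the mean
    bring the kurtosis to at least 2 on average, whatever the distribution. *)
Lemma uniform_kurtosis_ge2 : 2 <= c.
Proof.
pose s := Num.sqrt v; have s2 : s ^+ 2 = v by rewrite sqr_sqrtr// ltW.
have [M hM leM] := has_mean4 (m + s); have [N hN leN] := has_mean4 (m - s).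
have le16 : 16 * v ^+ 2 <= M + N.
  have h := has_meanZ (16 * v) centered2.
  apply: le_trans (has_mean_le h (has_meanD hM hN) _).
    by rewrite expr2 mulrA.
  move=> w /=; set z := Y w - m.
  have -> : Y w - (m + s) = z - s by rewrite /z; ring.
  have -> : Y w - (m - s) = z + s by rewrite /z; ring.
  have -> : (z - s) ^+ 4 + (z + s) ^+ 4 =
    2 * (z ^+ 2) ^+ 2 + 12 * s ^+ 2 * z ^+ 2 + 2 * (s ^+ 2) ^+ 2 by ring.
  rewrite s2 -subr_ge0 [leRHS](_ : _ = 2 * (z ^+ 2 - v) ^+ 2); last by ring.
  by rewrite mulr_ge0// sqr_ge0.
have E1 : second_moment (m + s) = 2 * v by rewrite /second_moment -s2; ring.
have E2 : second_moment (m - s) = 2 * v by rewrite /second_moment -s2; ring.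
rewrite E1 in leM; rewrite E2 in leN.
have v2 : 0 < v ^+ 2 by rewrite exprn_gt0.
have : 16 * v ^+ 2 <= 8 * c * v ^+ 2 by nra.
by rewrite ler_pM2r//; lra.
Qed.

End Moments.

(** * Exponential deviation bounds for independent samples *)

Section Chernoff.
Context d (T : measurableType d) (R : realType) (P : probability T R).
Context (I : finType) (X : I -> {RV P >-> R}) (hX : mutually_independent X).
Context (Y : {RV P >-> R}).

Lemma has_mean_quad (f : T -> R) e s : has_mean P f e ->
  has_mean P (fun w => f w ^+ 2) s -> has_mean P (fun w => quad (f w)) (1 + e + s / 2).
Proof.
move=> he hs; have := has_meanD (has_meanD (has_mean_cst P 1) he) (has_meanZ 2^-1 hs).
by apply: eq_has_mean => [w|]; rewrite /quad /= [2^-1 * _]mulrC.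
Qed.

Lemma integral_identically_distributed (Z : {RV P >-> R}) (g : R -> \bar R) :
  identically_distributed Z Y -> measurable_fun setT g -> (forall u, (0 <= g u)%E) ->
  (\int[distribution P Z]_u g u = \int[P]_w g (Y w))%E.
Proof.
move=> ZY mg g0; rewrite -(@ge0_integral_distribution _ _ _ _ _ P Y g)//.
by apply: eq_measure_integral => A mA _; exact: ZY.
Qed.

(** The factors are integrated out one at a time. *)
Lemma integral_indep_prod (J : seq I) (g : R -> R) (a : R) : uniq J ->
  (forall j, j \in J -> identically_distributed (X j) Y) ->
  measurable_fun setT g -> (forall u, 0 <= g u) ->
  has_mean P (fun w => g (Y w)) a ->
  (\int[P]_w (\prod_(j <- J) g (X j w))%:E = (a ^+ size J)%:E)%E.
Proof.
move=> uJ XY mg g0 [_ ga]; elim: J uJ XY => [_ _|s J IHJ /= /andP[sJ uJ] XY].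
  under eq_integral do rewrite big_nil.
  by rewrite (integral_cst P measurableT 1%:E)/= probability_setT mule1.
have IH : (\int[P]_w (\prod_(j <- J) g (X j w))%:E = (a ^+ size J)%:E)%E.
  by apply: IHJ => // j jJ; apply: XY; rewrite inE jJ orbT.
have sJ' : s \notin [set j in J]%SET by rewrite inE.
pose h (z : cyl_space X [set j in J]%SET * R) : \bar R :=
  (g z.2 * \prod_(j <- J) g (X j z.1))%:E.
have prod0 w : 0 <= \prod_(j <- J) g (X j w) by apply: prodr_ge0.
have mprodO : measurable_fun [set: cyl_space X [set j in J]%SET]
    (fun w => \prod_(j <- J) g (X j w)).
  apply: measurable_prod => j jJ; apply: (measurableT_comp mg).
  by apply: measurable_cylinders_fun; rewrite inE.
have mh : measurable_fun setT h.
  apply/measurable_EFinP; apply: measurable_funM.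
    exact: (measurableT_comp mg).
  exact: (measurableT_comp mprodO).
transitivity (\int[P]_w h (w, X s w))%E.
  by apply: eq_integral => w _; rewrite big_cons.
rewrite (indep_tonelli hX sJ' mh); last first.
  by move=> z; rewrite lee_fin mulr_ge0.
transitivity (\int[P]_w (a%:E * (\prod_(j <- J) g (X j w))%:E))%E.
  apply: eq_integral => w _; rewrite /h/=.
  under eq_integral do rewrite EFinM.
  rewrite ge0_integralZr//=; last 3 first.
  - exact/measurable_EFinP.
  - by move=> u _; rewrite lee_fin.
  - by rewrite lee_fin.
  rewrite integral_identically_distributed ?ga//.
  - by apply: XY; rewrite mem_head.
  - exact/measurable_EFinP.
have mprod : measurable_fun setT (fun w => \prod_(j <- J) g (X j w)).
  by apply: measurable_prod => j jJ; apply: (measurableT_comp mg).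
have a0 : 0 <= a by rewrite -lee_fin -ga; apply: integral_ge0 => w _; rewrite lee_fin.
rewrite ge0_integralZl//=.
- by rewrite IH -EFinM exprS.
- exact/measurable_EFinP.
- by move=> w _; rewrite lee_fin.
Qed.

(** Markov's inequality for the product of the [g (X j)], whose logarithm is the sum
    under consideration. *)
Lemma iid_chernoff (J : seq I) (g : R -> R) (a b L : R) : uniq J ->
  (forall j, j \in J -> identically_distributed (X j) Y) ->
  measurable_fun setT g -> (forall u, 0 < g u) ->
  has_mean P (fun w => g (Y w)) a -> a <= expR b ->
  (P [set w | ((size J)%:R * b + L <= \sum_(j <- J) ln (g (X j w)))%R] <=
   (expR (- L))%:E)%E.
Proof.
move=> uJ XY mg g0 ga ab; set E := [set w | _].
have mprod : measurable_fun setT (fun w => \prod_(j <- J) g (X j w)).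
  by apply: measurable_prod => j jJ; apply: (measurableT_comp mg).
have lnprod w : \sum_(j <- J) ln (g (X j w)) = ln (\prod_(j <- J) g (X j w)).
  elim: J {uJ XY E mprod} => [|j J IH]; first by rewrite !big_nil ln1.
  by rewrite !big_cons lnM ?posrE ?prodr_gt0// IH.
have mE : measurable E.
  rewrite -[E]setTI; apply: measurable_fun_le => //.
  by apply: measurable_sum => j; apply: measurableT_comp => //; exact: measurableT_comp.
have a0 : 0 <= a.
  by rewrite -lee_fin -ga.2; apply: integral_ge0 => w _; rewrite lee_fin ltW.
set t := _ + L in E mE *.
suff : ((expR t)%:E * P E <= (expR (t - L))%:E)%E.
  rewrite -lee_pdivlMl ?expR_gt0// -EFinM -expRN -expRD.
  by rewrite (_ : - t + (t - L) = - L)//; ring.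
rewrite -(integral_cst P mE (expR t)%:E).
have int := integral_indep_prod uJ XY mg (fun u => ltW (g0 u)) ga.
apply: (@le_trans _ _ (\int[P]_(w in E) (\prod_(j <- J) g (X j w))%:E)%E).
  apply: ge0_le_integral => //.
  - by move=> w _; rewrite lee_fin expR_ge0.
  - exact/measurable_funTS/measurable_EFinP.
  - move=> w; rewrite /E/= lnprod lee_fin => h.
    by rewrite -[leRHS]lnK ?posrE ?prodr_gt0// ler_expR.
apply: (@le_trans _ _ (\int[P]_w (\prod_(j <- J) g (X j w))%:E)%E).
  apply: ge0_subset_integral => //; first exact/measurable_EFinP.
  by move=> w _; rewrite lee_fin prodr_ge0// => i _; exact/ltW.
rewrite int lee_fin /t addrK expRM_natl.
by rewrite lerXn2r ?nnegrE// expR_ge0.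
Qed.

End Chernoff.

(** * Measurability of the estimators *)

Lemma measurable_quad (R : realType) : measurable_fun setT (@quad R).
Proof. apply: continuous_measurable_fun; exact: continuous_quad. Qed.

Lemma measurable_soft_threshold (R : realType) : measurable_fun setT (@soft_threshold R).
Proof.
have -> : @soft_threshold R = fun x => 2^-1 * (ln (quad x) - ln (quad (- x))).
  by apply/funext => x; exact: soft_thresholdE.
apply: measurable_funM => //; apply: measurable_funB.
  exact: (measurableT_comp (@measurable_ln R) (@measurable_quad R)).
apply: (measurableT_comp (@measurable_ln R)).
apply: (measurableT_comp (@measurable_quad R)); exact: measurable_funN.
Qed.

(* Writing the inverse as x * (x ^+ 2) `^ (-1) gives the right value 0 at 0. *)
Lemma measurable_inv (R : realType) : measurable_fun setT (@GRing.inv R).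
Proof.
have -> : @GRing.inv R = fun x => x * powR (x ^+ 2) (-1).
  apply/funext => x; rewrite powR_inv1 ?sqr_ge0//.
  have [->|x0] := eqVneq x 0; first by rewrite invr0 mul0r.
  by rewrite expr2 invfM mulrA mulfV// mul1r.
apply: measurable_funM => //.
have msq : measurable_fun setT (fun x : R => x ^+ 2) by exact: measurable_funX.
exact: (measurableT_comp (measurable_powR (-1)) msq).
Qed.

Lemma measurable_sqrt (R : realType) : measurable_fun setT (@Num.sqrt R).
Proof. apply: continuous_measurable_fun; exact: sqrt_continuous. Qed.

Section MeasurableEstimators.
Context (R : realType) (n : nat) dO (O : measurableType dO).
Context (y : O -> 'I_n -> R) (my : forall i, measurable_fun setT (y ^~ i)).

Lemma measurable_Qfun (theta alpha : O -> R) (delta : R) :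
  measurable_fun setT theta -> measurable_fun setT alpha ->
  measurable_fun setT (fun o => Qfun (y o) (theta o) delta (alpha o)).
Proof.
move=> mt ma.
rewrite [X in measurable_fun _ X](_ : _ = fun o => n%:R^-1 *
  \sum_(i < n) ln (quad (alpha o * (y o i - theta o) ^+ 2 - delta))); last first.
  by apply/funext => o; rewrite QfunE.
apply: measurable_funM => //; apply: measurable_sum => i.
apply: (measurableT_comp (@measurable_ln R)).
apply: (measurableT_comp (@measurable_quad R)).
apply: measurable_funB => //; apply: measurable_funM => //.
by apply: measurable_funX; apply: measurable_funB.
Qed.

Lemma measurable_theta_hat (alpha theta : O -> R) :
  measurable_fun setT alpha -> measurable_fun setT theta ->
  measurable_fun setT (fun o => theta_hat (y o) (alpha o) (theta o)).
Proof.
move=> ma mt; apply: measurable_funD => //; apply: measurable_funM.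
  by apply: (measurableT_comp (@measurable_inv R)); exact: measurable_funM.
apply: measurable_sum => i; apply: (measurableT_comp (@measurable_soft_threshold R)).
by apply: measurable_funM => //; exact: measurable_funB.
Qed.

End MeasurableEstimators.

Section QinvMeasurable.
Context (R : realType) (n : nat) (hn : (0 < n)%N) (delta z : R) (d1 : delta <= 1).

Lemma Qinv_ge0 (y : 'I_n -> R) theta : 0 <= Qinv y theta delta z.
Proof. by rewrite /Qinv; case: xgetP => // a _ []. Qed.

Lemma Qinv_gtP (y : 'I_n -> R) theta t : (exists i, y i != theta) -> 0 <= t ->
  t < Qinv y theta delta z <->
  Qfun y theta delta t < z /\ exists N, z <= Qfun y theta delta N%:R.
Proof.
move=> nc t0; split.
  rewrite /Qinv; case: xgetP => [a aE [a0 Qa]|_]; last by rewrite ltNge t0.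
  move=> ta; split; first by rewrite -Qa; exact: Qfun_lt.
  exists (Num.truncn a).+1; rewrite -Qa ltW// Qfun_lt//.
  exact: truncnS_gt.
move=> [Qt [N QN]].
have tN : t < N%:R.
  by apply: (Qfun_lt_arg hn (y := y) (theta := theta) d1) => //; exact: lt_le_trans QN.
have [q0 Qq] := Qinv_solution t0 (ltW tN) (ltW Qt) QN.
by apply: (Qfun_lt_arg hn (y := y) (theta := theta) d1) => //; rewrite Qq.
Qed.

Context dO (O : measurableType dO) (y : O -> 'I_n -> R) (theta : O -> R).
Hypotheses (my : forall i, measurable_fun setT (y ^~ i)) (mt : measurable_fun setT theta).

(** The sets where the inverse exceeds a given level are described by values of
    $Q_{\theta,\delta}$ at countably many points, except on the measurable set where
    all observations are equal to $\theta$; there the inverse is a constant. *)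
Lemma measurable_Qinv : measurable_fun setT (fun o => Qinv (y o) (theta o) delta z).
Proof.
pose Z := \bigcap_(i in [set: 'I_n]) [set o | y o i = theta o].
have mZ : measurable Z.
  apply: fin_bigcap_measurable => // i _.
  have -> : [set o | y o i = theta o] =
      [set o | y o i <= theta o] `&` [set o | theta o <= y o i].
    apply/seteqP; split=> o /=; first by move=> ->.
    by move=> [? ?]; apply/le_anti/andP.
  by apply: measurableI; rewrite -[X in measurable X]setTI; apply: measurable_fun_le.
pose kappa := Qinv (fun _ : 'I_n => 0) 0 delta z.
have ZE o : Z o -> Qinv (y o) (theta o) delta z = kappa.
  move=> Zo; rewrite /kappa /Qinv; congr (xget _ _); apply/seteqP.
  have QE a : Qfun (y o) (theta o) delta a = Qfun (fun _ : 'I_n => 0) 0 delta a.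
    rewrite !QfunE; congr (_ * _); apply: eq_bigr => i _.
    by rewrite (Zo i)// !subrr.
  by split=> a /=; rewrite QE.
have nZ o : ~ Z o -> exists i, y o i != theta o.
  move=> nZo; apply: contrapT => /forallNP h; apply: nZo => i _ /=.
  by apply/eqP; move: (h i) => /negP; rewrite negbK.
have mQ t : measurable_fun setT (fun o => Qfun (y o) (theta o) delta t).
  exact: measurable_Qfun.
have mB t : measurable [set o | Qfun (y o) (theta o) delta t < z].
  have -> : [set o | Qfun (y o) (theta o) delta t < z] =
      ~` [set o | z <= Qfun (y o) (theta o) delta t].
    by apply/seteqP; split=> o /=; rewrite ltNge => /negP.
  by apply: measurableC; rewrite -[X in measurable X]setTI; apply: measurable_fun_le.
have mC N : measurable [set o | z <= Qfun (y o) (theta o) delta N%:R].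
  by rewrite -[X in measurable X]setTI; apply: measurable_fun_le.
apply: (@measurability _ _ O R _ _ (@RGenOInfty.G R)).
  exact: RGenOInfty.measurableE.
move=> _ [_ [t ->] <-]; rewrite setTI.
have -> : (fun o => Qinv (y o) (theta o) delta z) @^-1` `]t, +oo[ =
  (Z `&` [set o | t < kappa]) `|` (~` Z `&` ([set o | t < 0] `|`
   ([set o | Qfun (y o) (theta o) delta t < z] `&`
     \bigcup_N [set o | z <= Qfun (y o) (theta o) delta N%:R]))).
  apply/seteqP; split=> o /=; rewrite in_itv/= andbT.
  - move=> tq; have [Zo|Zo] := pselect (Z o); first by left; rewrite -(ZE o).
    right; split=> //; have [t0|t0] := ltP t 0; first by left.
    have [Qt [N QN]] := (Qinv_gtP (nZ o Zo) t0).1 tq.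
    by right; split=> //; exists N.
  - case=> [[Zo]|[Zo]]; first by rewrite ZE.
    case=> [t0|[Qt [N _ QN]]]; first by rewrite (lt_le_trans t0)// Qinv_ge0.
    have [t0|t0] := ltP t 0; first by rewrite (lt_le_trans t0)// Qinv_ge0.
    by apply: (Qinv_gtP (nZ o Zo) t0).2; split=> //; exists N.
have mcst (b : bool) : measurable [set _ : O | b].
  case: b; [rewrite (_ : mkset _ = setT)|rewrite (_ : mkset _ = set0)] => //.
    by apply/seteqP; split.
  by apply/seteqP; split.
apply: measurableU; first exact: measurableI.
apply: measurableI; first exact: measurableC.
apply: measurableU => //; apply: measurableI => //.
exact: bigcupT_measurable.
Qed.

End QinvMeasurable.

(** * Deviations at a fixed parameter *)

Lemma measure_setU_le d (T : measurableType d) (R : realType)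
    (P : probability T R) (A B : set T) (a b : R) :
  measurable A -> measurable B ->
  (P A <= a%:E)%E -> (P B <= b%:E)%E -> (P (A `|` B) <= (a + b)%:E)%E.
Proof.
by move=> mA mB Aa Bb; rewrite (le_trans (measureU2 _ _ _))// EFinD leeD.
Qed.

Section Deviations.
Context d (T : measurableType d) (R : realType) (P : probability T R).
Context (I : finType) (X : I -> {RV P >-> R}) (hX : mutually_independent X).
Context (n : nat) (hn : (0 < n)%N) (e : 'I_n -> I) (e_inj : injective e).
Context (Y : {RV P >-> R}) (m v c : R).
Context (hm : ('E_P[Y] = m%:E)%E) (hv : ('V_P[Y] = v%:E)%E) (hv0 : 0 < v)
  (hc : uniform_kurtosis P Y = c%:E).
Hypothesis XY : forall j, identically_distributed (X (e j)) Y.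

Let sample (w : T) : 'I_n -> R := fun j => X (e j) w.

Lemma sample_chernoff (g : R -> R) (a b L : R) :
  measurable_fun setT g -> (forall u, 0 < g u) ->
  has_mean P (fun w => g (Y w)) a -> a <= expR b ->
  (P [set w | (n%:R * b + L <= \sum_(j < n) ln (g (sample w j)))%R] <=
   (expR (- L))%:E)%E.
Proof.
move=> mg g0 ga ab; pose J := [seq e j | j <- enum 'I_n].
have uJ : uniq J by rewrite map_inj_uniq// enum_uniq.
have sJ : size J = n by rewrite size_map size_enum_ord.
have := @iid_chernoff _ _ _ P _ _ hX Y J g a b L uJ _ mg g0 ga ab; rewrite sJ => h.
apply: le_trans (h _); last by move=> _ /mapP[j _ ->].
rewrite le_eqVlt; apply/orP; left; apply/eqP; congr (P _); apply/seteqP.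
by split=> w /=; rewrite /J big_map big_enum.
Qed.

Local Notation mu := (second_moment m v).

Let msample j : measurable_fun setT (fun w => sample w j).
Proof. exact: measurable_funPT. Qed.

(** At the point $\alpha = t/\mu$ the argument of [quad] has mean $t - \delta$ and,
    by definition of the kurtosis, second moment at most
    $(t-\delta)^2 + (c-1)t^2$. The two tails are distinguished by the sign
    $(-1)^{sg}$. *)
Lemma Qfun_tail (sg : bool) (theta delta t L z : R) :
  let Q w := Qfun (sample w) theta delta (t / mu theta) in
  n%:R * ((-1) ^+ sg * (t - delta) + ((t - delta) ^+ 2 + (c - 1) * t ^+ 2) / 2) + L =
    n%:R * z ->
  (P [set w | (z <= (-1) ^+ sg * Q w)%R] <= (expR (- L))%:E)%E.
Proof.
move=> Q hz; pose al := t / mu theta.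
have mu0 : 0 < mu theta by exact: second_moment_gt0.
have tE : al * mu theta = t by rewrite /al divfK// gt_eqF.
pose f (u : R) := (-1) ^+ sg * (al * (u - theta) ^+ 2 - delta).
have mf : measurable_fun setT f.
  apply: measurable_funM => //; apply: measurable_funB => //.
  by apply: measurable_funM => //; apply: measurable_funX; exact: measurable_funB.
have [M hM leM] := has_mean4 hm hv hv0 hc theta.
have h2 := has_mean2 hm hv theta.
have hf : has_mean P (fun w => f (Y w)) ((-1) ^+ sg * (t - delta)).
  have := has_meanZ ((-1) ^+ sg) (has_meanD (has_meanZ al h2) (has_mean_cst P (- delta))).
  by apply: eq_has_mean => //; rewrite tE.
have hf2 : has_mean P (fun w => f (Y w) ^+ 2)
    (al ^+ 2 * M + - 2 * delta * t + delta ^+ 2).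
  have := has_meanD (has_meanD (has_meanZ (al ^+ 2) hM)
    (has_meanZ (- 2 * delta * al) h2)) (has_mean_cst P (delta ^+ 2)).
  apply: eq_has_mean => [w|].
    by rewrite /f [RHS]exprMn sqrr_sign /=; ring.
  by rewrite -tE; ring.
have le_exp : 1 + (-1) ^+ sg * (t - delta) +
    (al ^+ 2 * M + - 2 * delta * t + delta ^+ 2) / 2 <=
    expR ((-1) ^+ sg * (t - delta) + ((t - delta) ^+ 2 + (c - 1) * t ^+ 2) / 2).
  apply: le_trans (expR_ge1Dx _).
  have : al ^+ 2 * M <= c * t ^+ 2.
    apply: le_trans (ler_wpM2l (sqr_ge0 al) leM) _.
    by rewrite -tE le_eqVlt; apply/orP; left; apply/eqP; ring.
  lra.
have := sample_chernoff L (measurableT_comp (@measurable_quad R) mf)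
  (fun u => quad_gt0 _) (has_mean_quad hf hf2) le_exp.
apply: le_trans; apply: le_measure.
- rewrite inE -[X in measurable X]setTI; apply: measurable_fun_le => //.
  by apply: measurable_funM => //; exact: measurable_Qfun.
- rewrite inE -[X in measurable X]setTI; apply: measurable_fun_le => //.
  apply: measurable_sum => j; apply: (measurableT_comp (@measurable_ln R)).
  by apply: (measurableT_comp (@measurable_quad R)); exact: (measurableT_comp mf).
move=> w /=; rewrite hz /Q QfunE.
have n0 : 0 < n%:R :> R by rewrite ltr0n.
rewrite mulrCA mulrC -(ler_pM2l n0) [leRHS]mulrCA mulfV ?gt_eqF// ?mulr1.
move=> /le_trans; apply.
rewrite mulr_sumr; apply: ler_sum => j _; rewrite /f -/al.
case: sg {Q hz f mf hf hf2 le_exp}; last by rewrite expr0 !mul1r.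
by rewrite expr1 !mulN1r; exact: ln_quadN.
Qed.

(** Here [quad] has argument $\pm\alpha(Y-\theta)$, of second moment $\alpha^2\mu$, and
    the truncation $T$ is bounded on both sides by logarithms of [quad]. *)
Lemma theta_hat_tail (sg : bool) (theta alpha L zeta : R) : 0 < alpha ->
  alpha ^+ 2 * mu theta / 2 + L / n%:R <= alpha * zeta ->
  (P [set w | (zeta <= (-1) ^+ sg * (theta_hat (sample w) alpha theta - m))%R] <=
   (expR (- L))%:E)%E.
Proof.
move=> alpha0 hz.
pose f (u : R) := (-1) ^+ sg * (alpha * (u - theta)).
have mf : measurable_fun setT f.
  apply: measurable_funM => //; apply: measurable_funM => //.
  exact: measurable_funB.
have h2 := has_mean2 hm hv theta; have h1 := has_mean1 hm hv theta.
have hf : has_mean P (fun w => f (Y w)) ((-1) ^+ sg * (alpha * (m - theta))).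
  exact: (has_meanZ ((-1) ^+ sg) (has_meanZ alpha h1)).
have hf2 : has_mean P (fun w => f (Y w) ^+ 2) (alpha ^+ 2 * mu theta).
  have := has_meanZ (alpha ^+ 2) h2.
  by apply: eq_has_mean => [w|//]; rewrite /f [RHS]exprMn sqrr_sign /=; ring.
have le_exp : 1 + (-1) ^+ sg * (alpha * (m - theta)) + alpha ^+ 2 * mu theta / 2 <=
    expR ((-1) ^+ sg * (alpha * (m - theta)) + alpha ^+ 2 * mu theta / 2).
  by apply: le_trans (expR_ge1Dx _); rewrite addrA.
have := sample_chernoff L (measurableT_comp (@measurable_quad R) mf)
  (fun u => quad_gt0 _) (has_mean_quad hf hf2) le_exp.
apply: le_trans; apply: le_measure.
- rewrite inE -[X in measurable X]setTI; apply: measurable_fun_le => //.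
  apply: measurable_funM => //; apply: measurable_funB => //.
  exact: measurable_theta_hat.
- rewrite inE -[X in measurable X]setTI; apply: measurable_fun_le => //.
  apply: measurable_sum => j; apply: (measurableT_comp (@measurable_ln R)).
  by apply: (measurableT_comp (@measurable_quad R)); exact: (measurableT_comp mf).
move=> w /=.
have n0 : 0 < n%:R :> R by rewrite ltr0n.
set S := \sum_(i < n) soft_threshold (alpha * (sample w i - theta)).
have thetaE : n%:R * alpha * (theta_hat (sample w) alpha theta - theta) = S.
  by rewrite /theta_hat -/S addrAC subrr add0r mulVKf// mulf_neq0 ?gt_eqF.
move=> h; apply: (@le_trans _ _ ((-1) ^+ sg * S)); last first.
  rewrite mulr_sumr; apply: ler_sum => j _; rewrite /f.
  case: (sg); last by rewrite expr0 !mul1r; exact: soft_threshold_le.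
  by rewrite expr1 !mulN1r; exact: soft_threshold_ge.
have na0 : 0 < n%:R * alpha by rewrite mulr_gt0.
have := ler_wpM2l (ltW na0) h; rewrite -thetaE.
have := ler_wpM2l (ltW n0) hz; rewrite mulrDr [n%:R * (L / _)]mulrC divfK ?gt_eqF//.
set s := (-1) ^+ sg; set th := theta_hat _ _ _; nra.
Qed.

End Deviations.

(** * Affine images of a uniform variable *)

Section UniformAffine.
Context (R : realType).
Local Notation mu := (@lebesgue_measure R).
Local Notation nu := (uniform_prob (ltrN11 R)).

Let affine (a r u : R) : measurableTypeR R := a + r * u.

Let measurable_affine a r : measurable_fun [set: measurableTypeR R] (affine a r).
Proof. by apply: (@measurable_funD _ _ R) => //; exact: (@measurable_funM _ _ R). Qed.

(* Lebesgue measure is determined by its values on half-open intervals. *)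
Let lebesgue_affine (a r : R) (r0 : 0 < r) (A : set R) : measurable A ->
  mu A = (r%:E * pushforward mu (affine a r) A)%E.
Proof.
move=> mA.
pose af : {mfun measurableTypeR R >-> measurableTypeR R} := HB.pack (affine a r)
  (isMeasurableFun.Build _ _ _ _ _ (measurable_affine a r)).
rewrite (@lebesgue_measure_unique _ (mscale (NngNum (ltW r0)) (pushforward mu af)))//.
move=> _ [[x y] _ <-]; rewrite -[RHS]/(r%:E * mu (affine a r @^-1` `]x, y]))%E.
have -> : affine a r @^-1` `]x, y] = `](x - a) / r, (y - a) / r]%classic.
  apply/seteqP; split=> u /=; rewrite !in_itv/= /affine.
    by rewrite ltr_pdivrMr// ler_pdivlMr// mulrC => /andP[? ?]; apply/andP; split; lra.
  by rewrite ltr_pdivrMr// ler_pdivlMr// mulrC => /andP[? ?]; apply/andP; split; lra.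
rewrite !lebesgue_measure_itv/= !lte_fin ltr_pM2r ?invr_gt0// ltrBlDr subrK.
case: ifPn => _; last by rewrite mule0.
by rewrite -!EFinB -EFinM; congr (_%:E); field; rewrite gt_eqF.
Qed.

Lemma integral_uniform_affine (a r : R) (g : R -> \bar R) : 0 < r ->
  measurable_fun setT g -> (forall u, (0 <= g u)%E) ->
  (\int[nu]_u g (a + r * u)%R =
   ((2 * r)^-1)%:E * \int[mu]_(u in `[(a - r)%R, (a + r)%R]) g u)%E.
Proof.
move=> r0 mg g0.
have mgaf : measurable_fun [set: measurableTypeR R] (fun u => g (affine a r u)).
  exact: measurableT_comp.
rewrite integral_uniform//.
pose af : {mfun measurableTypeR R >-> measurableTypeR R} := HB.pack (affine a r)
  (isMeasurableFun.Build _ _ _ _ _ (measurable_affine a r)).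
pose m' : {measure set (measurableTypeR R) -> \bar R} :=
  mscale (NngNum (ltW r0)) (pushforward mu af).
rewrite [in RHS](@eq_measure_integral _ (measurableTypeR R) R
  `[(a - r)%R, (a + r)%R]%classic (m' (measurable_affine a r))); last first.
  by move=> A mA _; exact: lebesgue_affine.
rewrite ge0_integral_mscale//; last exact: measurable_funTS.
rewrite ge0_integral_pushforward//; last exact: measurable_funTS.
rewrite muleA -EFinM/=.
have -> : (affine a r @^-1` `[a - r, a + r]) = `[-1, 1]%classic.
  apply/seteqP; split=> u /=; rewrite !in_itv/= /affine => /andP[? ?]; apply/andP.
    by split; nra.
  by split; nra.
by congr (_%:E * _)%E; field; rewrite gt_eqF.
Qed.

Let measurable_idR : measurable_fun [set: measurableTypeR R] (id : measurableTypeR R -> R).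
Proof. exact: measurable_id. Qed.

Let idR : {mfun measurableTypeR R >-> R} := HB.pack (id : measurableTypeR R -> R)
  (isMeasurableFun.Build _ _ _ _ _ measurable_idR).

(** The uniform law on $[-1,1]$ as a probability on the measurable space in which
    real random variables take their values. *)
Definition uniform11 : probability R R := distribution nu idR.

Lemma integral_uniform11 (g : R -> \bar R) :
  measurable_fun setT g -> (forall u, (0 <= g u)%E) ->
  (\int[uniform11]_u g u = \int[nu]_u g u)%E.
Proof. by move=> mg g0; rewrite ge0_integral_pushforward. Qed.

Lemma integral_uniform11_le (g : R -> \bar R) (b : R) :
  measurable_fun setT g -> (forall u, (0 <= g u)%E) ->
  (forall u, -1 <= u <= 1 -> (g u <= b%:E)%E) -> (\int[uniform11]_u g u <= b%:E)%E.
Proof.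
move=> mg g0 gb; rewrite integral_uniform11// integral_uniform//.
apply: (@le_trans _ _ (((1 - -1)^-1)%:E * \int[mu]_(x in `[(-1)%R, 1%R]) b%:E))%E.
  apply: lee_wpmul2l; first by rewrite lee_fin invr_ge0; lra.
  apply: ge0_le_integral => //; exact: measurable_funTS.
rewrite integral_cst//= lebesgue_measure_itv/= lte_fin ltrN11 -EFinD -!EFinM lee_fin.
by rewrite mulrC mulfK ?lexx// gt_eqF//; lra.
Qed.

(** The interval $[a-r,a+r]$ is contained in $[b-s,b+s]$, and the two uniform densities
    are constants whose ratio is $s/r$. *)
Lemma integral_uniform_widen (a r b s : R) (g : R -> \bar R) : 0 < r ->
  `|a - b| <= s - r -> measurable_fun setT g -> (forall u, (0 <= g u)%E) ->
  (\int[uniform11]_u g (a + r * u)%R <=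
   (s / r)%:E * \int[uniform11]_u g (b + s * u)%R)%E.
Proof.
move=> r0 abs mg g0.
have s0 : 0 < s by have := normr_ge0 (a - b); lra.
have maff (t w : R) : measurable_fun setT (fun u : R => g (t + w * u)).
  apply: measurableT_comp => //.
  by apply: (@measurable_funD _ _ R) => //; exact: (@measurable_funM _ _ R).
rewrite !integral_uniform11// !integral_uniform_affine// muleA -EFinM.
have -> : s / r * (2 * s)^-1 = (2 * r)^-1 by field; rewrite !gt_eqF.
apply: lee_wpmul2l; first by rewrite lee_fin invr_ge0 mulr_ge0// ltW.
apply: ge0_subset_integral => //; first exact: measurable_funTS.
move: abs; rewrite ler_norml => /andP[? ?] u /=; rewrite !in_itv/= => /andP[? ?].
by apply/andP; split; lra.
Qed.

End UniformAffine.

(** * From deterministic to data-dependent parameters *)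

Lemma integral_uniformly_distributed d (T : measurableType d) (R : realType)
    (P : probability T R) (Z : {RV P >-> R}) (g : R -> \bar R) :
  uniformly_distributed (ltrN11 R) Z ->
  (\int[distribution P Z]_u g u = \int[uniform11 R]_u g u)%E.
Proof. by move=> ZU; apply: eq_measure_integral => A mA _; exact: ZU. Qed.

Lemma probability_setI1 d (T : measurableType d) (R : realType)
    (P : probability T R) (A B : set T) :
  measurable A -> measurable B -> P B = 1%E -> P (A `&` B) = P A.
Proof.
move=> mA mB PB; rewrite (measureDI P mA mB) [X in (X + _)%E](_ : _ = 0%E) ?add0e//.
apply/eqP; rewrite -measure_le0.
have <- : P (~` B) = 0%E by rewrite probability_setC// PB subee.
apply: le_measure; rewrite ?inE; first exact: measurableD.
- exact: measurableC.
- by move=> w [].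
Qed.

Section Transfer.
Context d (T : measurableType d) (R : realType) (P : probability T R).
Context (n N : nat) (Ys : 'I_n -> {RV P >-> R}) (U : nat -> {RV P >-> R}).

Let X (s : ('I_n + 'I_N)%type) : {RV P >-> R} :=
  match s with inl i => Ys i | inr j => U j end.

Hypothesis hX : mutually_independent X.
Hypothesis hU : forall j, (j < N)%N -> uniformly_distributed (ltrN11 R) (U j).

Local Notation nu := (uniform11 R).

Context dV (V : measurableType dV).
Let S : measurableType _ := n.-tuple R.
Let SV : measurableType _ := (S * V)%type.
Let SVR : measurableType _ := (SV * R)%type.
Let VR : measurableType _ := (V * R)%type.
(* [step j] draws the next parameter around a centre that depends on the sample,
   [istep j] around a deterministic one; [dom j] contains the parameters for which
   the failure probability of stage [j] is controlled. *)
Context (p0 : V) (step : nat -> SVR -> V) (istep : nat -> VR -> V)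
  (good : nat -> set SV) (dom : nat -> set V) (ratio bad : nat -> R).
Hypothesis mstep : forall j, (j < N)%N -> measurable_fun setT (step j).
Hypothesis mistep : forall j, measurable_fun setT (istep j).
Hypothesis mgood : forall j, measurable (good j).
Hypothesis ratio_ge0 : forall j, (j < N)%N -> 0 <= ratio j.
Hypothesis widen : forall j (z : SV) (g : V -> \bar R), (j < N)%N -> good j z ->
  measurable_fun setT g -> (forall p, (0 <= g p)%E) ->
  (\int[nu]_u g (step j (z, u)) <= (ratio j)%:E * \int[nu]_u g (istep j (z.2, u)))%E.
Hypothesis dom_istep : forall j p u, (j < N)%N -> dom j p -> -1 <= u <= 1 ->
  dom j.+1 (istep j (p, u)).
Hypothesis dom_p0 : dom 0 p0.

Definition sample (w : T) : S := [tuple Ys i w | i < n].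

Fixpoint param (j : nat) (w : T) : V :=
  if j is i.+1 then step i ((sample w, param i w), U i w) else p0.

Hypothesis bad_le : forall j p, (j <= N)%N -> dom j p ->
  (P [set w | ~ good j (sample w, p)] <= (bad j)%:E)%E.

Definition good_until (j : nat) : set T :=
  [set w | forall i, (i < j)%N -> good i (sample w, param i w)].

Lemma good_untilS j : good_until j.+1 =
  good_until j `&` [set w | good j (sample w, param j w)].
Proof.
apply/seteqP; split => w.
  by move=> h; split=> [i ij|]; apply: h => //; exact: ltnW.
move=> [h hj] i; rewrite ltnS leq_eqVlt => /orP[/eqP->//|]; exact: h.
Qed.

(* The map [toT] is always the identity: it lets the same statements serve for the
   original sigma-algebra of [T] and for coarser ones. *)
Section Measurability.
Context dO (O : measurableType dO) (k : nat) (kN : (k <= N)%N) (toT : O -> T).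
Hypothesis mYs : forall i, measurable_fun setT (fun o => Ys i (toT o)).
Hypothesis mU : forall j, (j < k)%N -> measurable_fun setT (fun o => U j (toT o)).

Lemma measurable_sample : measurable_fun setT (fun o => sample (toT o)).
Proof.
apply/measurable_fun_tnthP => i.
by apply: eq_measurable_fun (mYs i) => o _ /=; rewrite tnth_mktuple.
Qed.

Lemma measurable_param j : (j <= k)%N -> measurable_fun setT (fun o => param j (toT o)).
Proof.
elim: j => [|j IHj] jk /=; first exact: measurable_cst.
apply: measurableT_comp; first exact: (mstep (leq_trans jk kN)).
apply: measurable_fun_pair; last exact: mU.
by apply: measurable_fun_pair; [exact: measurable_sample|exact/IHj/ltnW].
Qed.

Lemma measurable_good_until j : (j <= k.+1)%N -> measurable (toT @^-1` good_until j).
Proof.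
elim: j => [_|j IHj jk].
  by rewrite (_ : _ @^-1` _ = setT)//; apply/seteqP; split.
rewrite good_untilS preimage_setI; apply: measurableI; first exact/IHj/ltnW.
have mz : measurable_fun setT (fun o => (sample (toT o), param j (toT o)) : SV).
  by apply: measurable_fun_pair; [exact: measurable_sample|exact: measurable_param].
by have := mz measurableT _ (mgood j); rewrite setTI.
Qed.

End Measurability.

Let past (j : nat) : {set 'I_n + 'I_N} :=
  [set s : 'I_n + 'I_N | if s is inr i then (i < j)%N else true]%SET.

(* What is known before the variable [U j] is drawn. *)
Let O (j : nat) : measurableType _ := cyl_space X (past j).

Let mYsO j i : measurable_fun [set: O j] (fun o => Ys i o).
Proof.
by apply: (@measurable_cylinders_fun _ _ _ _ _ X (past j) (inl i)); rewrite inE.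
Qed.

Let mUO j i : (j <= N)%N -> (i < j)%N -> measurable_fun [set: O j] (fun o => U i o).
Proof.
move=> jN ij; have iN := leq_trans ij jN.
apply: (@measurable_cylinders_fun _ _ _ _ _ X (past j) (inr (Ordinal iN))).
by rewrite inE.
Qed.

Let mYsT i : measurable_fun [set: T] (fun o => Ys i (id o)).
Proof. exact: measurable_funPT. Qed.

Let mUT k i : (i < k)%N -> measurable_fun [set: T] (fun o => U i (id o)).
Proof. by move=> _; exact: measurable_funPT. Qed.

(** By induction on [j]: the last perturbation is integrated out first, given the
    past; on the good event its law is replaced by the ideal one, at the price of
    the factor [ratio], which leaves a function of the previous parameter to which
    the induction hypothesis applies. By Tonelli's theorem this function satisfies
    the same bound for deterministic parameters as [f]. *)
Lemma transfer j (f : SV -> \bar R) (b : R) : (j <= N)%N ->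
  measurable_fun setT f -> (forall z, (0 <= f z)%E) ->
  (forall p, dom j p -> (\int[P]_w f (sample w, p) <= b%:E)%E) ->
  (\int[P]_w ((\1_(good_until j) w)%:E * f (sample w, param j w)) <=
   (\prod_(i < j) ratio i * b)%:E)%E.
Proof.
elim: j f b => [|j IHj] f b jN mf f0 fb.
  rewrite big_ord0 mul1r; apply: le_trans (fb _ dom_p0).
  rewrite le_eqVlt; apply/orP; left; apply/eqP; apply: eq_integral => w _.
  by rewrite indicE mem_set// mul1e.
pose F (z : SV) : \bar R := (\int[nu]_u f (z.1, istep j (z.2, u)))%E.
have mFi : measurable_fun setT (fun zu : SVR => f (zu.1.1, istep j (zu.1.2, zu.2))).
  apply: measurableT_comp => //; apply: measurable_fun_pair.
    exact: measurableT_comp.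
  apply: measurableT_comp => //; apply: measurable_fun_pair => //.
  exact: measurableT_comp.
have mF : measurable_fun setT F.
  by apply: (measurable_fun_fubini_tonelli_F (m2 := nu)
    (fun zu : SVR => f (zu.1.1, istep j (zu.1.2, zu.2)))).
have F0 z : (0 <= F z)%E by apply: integral_ge0.
have mstepT : measurable_fun setT (fun zu : SVR => f (zu.1.1, step j zu)).
  apply: measurableT_comp => //; apply: measurable_fun_pair; last exact: mstep.
  exact: measurableT_comp.
have hs : inr (Ordinal jN) \notin past j by rewrite inE /= ltnn.
pose h (z : O j * R) : \bar R :=
  ((\1_(good_until j.+1) z.1)%:E *
   f (sample z.1, step j ((sample z.1, param j z.1), z.2)))%E.
have msO : measurable_fun [set: O j] (fun o => (sample o, param j o) : SV).
  have m1 := @measurable_sample _ (O j) id (@mYsO j).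
  have m2 := @measurable_param _ (O j) j (ltnW jN) id (@mYsO j)
    (fun i => mUO (ltnW jN)) j (leqnn j).
  exact: measurable_fun_pair m1 m2.
have mh : measurable_fun setT h.
  apply: emeasurable_funM.
    apply/measurable_EFinP.
    apply: (@measurableT_comp _ _ _ _ _ _ (\1_(good_until j.+1) : O j -> R)) => //.
    apply: measurable_indic.
    exact: (@measurable_good_until _ (O j) j (ltnW jN) id (@mYsO j)
      (fun i => mUO (ltnW jN)) j.+1 (leqnn _)).
  apply: (@measurableT_comp _ _ _ _ _ _ (fun zu : SVR => f (zu.1.1, step j zu))
     _ (fun z : O j * R => ((sample z.1, param j z.1), z.2) : SVR)) => //.
  by apply: measurable_fun_pair => //; exact: (measurableT_comp msO).
have h0 z : (0 <= h z)%E by rewrite mule_ge0// lee_fin.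
apply: (@le_trans _ _ (\int[P]_w h (w, X (inr (Ordinal jN)) w))%E); first by [].
rewrite (indep_tonelli hX hs mh h0).
have hle w : (\int[distribution P (X (inr (Ordinal jN)))]_u h (w, u) <=
    (ratio j)%:E * ((\1_(good_until j) w)%:E * F (sample w, param j w)))%E.
  rewrite integral_uniformly_distributed; last exact: hU.
  have [wG|wG] := boolP (w \in good_until j.+1); last first.
    rewrite integral0_eq; first by rewrite !mule_ge0 ?lee_fin ?ratio_ge0.
    by move=> u _; rewrite /h/= indicE (negbTE wG) mul0e.
  have := wG; rewrite inE good_untilS => -[wGj wj].
  rewrite indicE (mem_set wGj) mul1e.
  apply: le_trans (@widen j (sample w, param j w) (fun p => f (sample w, p)) jN wj _ _) => //.
    rewrite le_eqVlt; apply/orP; left; apply/eqP; apply: eq_integral => u _.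
    by rewrite /h/= indicE wG mul1e.
  by apply: measurableT_comp => //; exact: measurable_fun_pair.
have mGj : measurable (good_until j).
  exact: (@measurable_good_until _ T j (ltnW jN) id mYsT (@mUT j) j (leqnSn j)).
have mzT : measurable_fun setT (fun w => (sample w, param j w) : SV).
  apply: measurable_fun_pair; first exact: (@measurable_sample _ T id mYsT).
  exact: (@measurable_param _ T j (ltnW jN) id mYsT (@mUT j) j (leqnn j)).
apply: (@le_trans _ _ (\int[P]_w
  ((ratio j)%:E * ((\1_(good_until j) w)%:E * F (sample w, param j w))))%E).
  apply: ge0_le_integral => //.
  - by move=> w _; apply: integral_ge0.
  - apply: (@measurableT_comp _ _ _ _ _ _
      (fun o : O j => \int[distribution P (X (inr (Ordinal jN)))]_u h (o, u))%E
      _ (id : T -> O j)) => //; last exact: measurable_cyl_id.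
    exact: (measurable_fun_fubini_tonelli_F h).
  - apply: emeasurable_funM => //; apply: emeasurable_funM.
      by apply/measurable_EFinP; exact: measurable_indic.
    exact: (measurableT_comp mF mzT).
rewrite ge0_integralZl//; last 3 first.
- apply: emeasurable_funM; first by apply/measurable_EFinP; exact: measurable_indic.
  exact: (measurableT_comp mF mzT).
- by move=> w _; rewrite mule_ge0// lee_fin.
- by rewrite lee_fin ratio_ge0.
rewrite big_ord_recr/= [_ * ratio j]mulrC -mulrA EFinM.
apply: lee_wpmul2l; first by rewrite lee_fin ratio_ge0.
apply: IHj (ltnW jN) mF F0 _ => p dp.
pose fp (wu : T * R) := f (sample wu.1, istep j (p, wu.2)).
have mfp : measurable_fun setT fp.
  apply: measurableT_comp => //; apply: measurable_fun_pair.
    by apply: measurableT_comp => //; exact: (@measurable_sample _ T id mYsT).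
  apply: measurableT_comp => //; exact: measurable_fun_pair.
rewrite (_ : (\int[P]_w _ = \int[P]_w \int[nu]_u fp (w, u))%E)//.
rewrite (fubini_tonelli (m1 := P) (m2 := nu) fp mfp (fun _ => f0 _)).
apply: integral_uniform11_le.
- exact: (measurable_fun_fubini_tonelli_G (m1 := P) fp mfp (fun _ => f0 _)).
- by move=> u; apply: integral_ge0 => w _; exact: f0.
- by move=> u u1; exact: (fb _ (dom_istep jN dp u1)).
Qed.

(** For [f] the indicator of the failure of stage [j], [transfer] says that this
    failure is as rare as for a deterministic parameter, up to the product of the
    density ratios. *)
Lemma failure_le j : (j <= N)%N -> (P (good_until j `\` good_until j.+1) <=
  (\prod_(i < j) ratio i * bad j)%:E)%E.
Proof.
move=> jN.
have mGj : measurable (good_until j).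
  exact: (@measurable_good_until _ T j jN id mYsT (@mUT j) j (leqnSn j)).
have mbad : measurable (~` good j) by exact: measurableC.
have mz : measurable_fun setT (fun w => (sample w, param j w) : SV).
  apply: measurable_fun_pair; first exact: (@measurable_sample _ T id mYsT).
  exact: (@measurable_param _ T j jN id mYsT (@mUT j) j (leqnn j)).
have mzp p : measurable_fun setT (fun w => (sample w, p) : SV).
  by apply: measurable_fun_pair => //; exact: (@measurable_sample _ T id mYsT).
pose f (z : SV) : \bar R := (\1_(~` good j) z)%:E.
have mf : measurable_fun setT f by apply/measurable_EFinP; exact: measurable_indic.
have fb p : dom j p -> (\int[P]_w f (sample w, p) <= (bad j)%:E)%E.
  move=> dp; rewrite -[leLHS]/(\int[P]_w (\1_([set w | ~ good j (sample w, p)]) w)%:E)%E.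
  rewrite integral_indic//= ?setIT; first exact: bad_le.
  by have := mzp p measurableT _ mbad; rewrite setTI.
apply: le_trans (transfer jN mf _ fb); last by move=> z; rewrite lee_fin.
have setE : good_until j `\` good_until j.+1 =
    good_until j `&` [set w | ~ good j (sample w, param j w)].
  rewrite good_untilS; apply/seteqP; split=> w [Gw].
    by move=> nG; split=> // gw; exact: nG.
  by move=> ng; split=> // -[_ /ng].
have mD : measurable (good_until j `\` good_until j.+1).
  rewrite setE; apply: measurableI => //.
  by have := mz measurableT _ mbad; rewrite setTI.
rewrite -[P _](_ : \int[P]_w (\1_(good_until j `\` good_until j.+1) w)%:E = _)%E.
  rewrite le_eqVlt; apply/orP; left; apply/eqP; apply: eq_integral => w _.
  by rewrite -EFinM setE indicI.
by rewrite integral_indic//= setIT.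
Qed.

(** A union bound over the first stage that fails. *)
Lemma good_until_ge (b : R) :
  \sum_(j < N.+1) \prod_(i < j) ratio i * bad j <= b ->
  measurable (good_until N.+1) /\ ((1 - b)%:E <= P (good_until N.+1))%E.
Proof.
have mG j : (j <= N.+1)%N -> measurable (good_until j).
  exact: (@measurable_good_until _ T N (leqnn N) id mYsT (@mUT N) j).
move=> sb; split; first exact: mG.
have {}sb : 1 - b <= 1 - \sum_(j < N.+1) \prod_(i < j) ratio i * bad j by lra.
apply: le_trans (_ : (1 - _)%:E <= _)%E; first by rewrite lee_fin; exact: sb.
elim: {-2}N.+1 (leqnn N.+1) => [_|j IHj jN].
  rewrite big_ord0 subr0 (_ : good_until 0 = setT) ?probability_setT//.
  by apply/seteqP; split.
have sub : good_until j.+1 `<=` good_until j by rewrite good_untilS; exact: subIsetl.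
have mGj := mG j (ltnW jN); have mGj1 := mG j.+1 jN.
have := IHj (ltnW jN); have := failure_le jN.
rewrite measureD//; last by rewrite (le_lt_trans (probability_le1 _ _)) ?ltry.
rewrite (setIidr sub) big_ord_recr/=.
rewrite -[P (good_until j)]fineK ?fin_num_measure//.
rewrite -[P (good_until j.+1)]fineK ?fin_num_measure//.
rewrite -EFinB !lee_fin; lra.
Qed.

Lemma uniforms_in_range : exists E0 : set T, [/\ measurable E0, P E0 = 1%E &
  forall w j, E0 w -> (j < N)%N -> -1 <= U j w <= 1].
Proof.
elim: N hU => [_|k IHk hUk]; first by exists setT; rewrite probability_setT.
have [|E0 [mE0 PE0 hE0]] := IHk _; first by move=> j jk; apply: hUk; exact: ltnW.
pose B := U k @^-1` `[-1, 1].
have mB : measurable B by exact: measurable_funPTI.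
have PB : P B = 1%E.
  rewrite -[LHS]/(distribution P (U k) `[-1, 1]%classic) hUk//.
  by rewrite /uniform_prob integral_uniform_pdf1.
exists (E0 `&` B); split; first exact: measurableI.
- by rewrite probability_setI1.
- move=> w j [Ew Bw]; rewrite ltnS leq_eqVlt => /orP[/eqP->|]; last exact: hE0.
  by move: Bw; rewrite /B/= in_itv.
Qed.

End Transfer.

(** * The stages as perturbation steps *)

Section Stages.
Context (R : realType) (k : nat) (x eps : nat -> R).
Hypothesis hx : forall i, (1 <= i <= 2 * k)%N -> 0 < x i.
Hypothesis heps : forall i, (1 <= i <= 2 * k)%N -> 0 < eps i < 1.

Local Notation level := (level x eps).

Lemma gamma_sum_ge0 i : (i <= 2 * k)%N -> 0 <= gamma_sum x i.
Proof.
move=> ik; rewrite /gamma_sum big_nat_cond sumr_ge0// => j /andP[/andP[j2 ji] _].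
by rewrite ln_ge0// lerDl invr_ge0 ltW// hx//; lia.
Qed.

Lemma level_gt0 i : (1 <= i <= 2 * k)%N -> 0 < level i.
Proof.
move=> ik; have /andP[e0 e1] := heps ik.
rewrite /level ltr_wpDr ?gamma_sum_ge0//; first by case/andP: ik.
by rewrite ln_gt0// invf_gt1.
Qed.

Lemma prod_ratio j : (j < 2 * k)%N ->
  \prod_(i < j) (1 + (x i.+2)^-1) = expR (gamma_sum x j.+1).
Proof.
elim: j => [|j IHj] jk; first by rewrite big_ord0 /gamma_sum big_geq// expR0.
rewrite big_ord_recr/= IHj; last lia.
rewrite /gamma_sum [in RHS]big_nat_recr//= expRD lnK// posrE addr_gt0// invr_gt0.
by apply: hx; lia.
Qed.

(** The terms [gamma_sum] of the confidence levels are exactly what compensates for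
    the product of the density ratios. *)
Lemma prod_ratio_level j : (j < 2 * k)%N ->
  \prod_(i < j) (1 + (x i.+2)^-1) * (2 * expR (- level j.+1)) = 2 * eps j.+1.
Proof.
move=> jk; have /andP[e0 _] : 0 < eps j.+1 < 1 by apply: heps; lia.
rewrite prod_ratio// mulrCA -expRD /Defs.level opprD addrCA subrr addr0.
by rewrite lnV ?posrE// opprK lnK.
Qed.

Context (n : nat) (hn : (0 < n)%N) (c : R).

Local Notation delta := (delta n c x eps).
Local Notation zeta_odd := (zeta_odd n c x eps).

Let h i := hfun (c / (c - 1)) ((c - 1) * delta i).

Let n0 : 0 < n%:R :> R. Proof. by rewrite ltr0n. Qed.

(** The parameter of an even stage [i] is the pair of the prior guess and of the
    perturbed second moment; that of an odd stage is the prior guess, with the second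
    moment of the previous stage carried along. The next four functions compute the
    output of a stage from its parameter. *)
Definition even_alpha i (q : R) : R :=
  expR (- ((1 + x i) * zeta_odd i.-1 / 2)) * Num.sqrt (2 * level i / (n%:R * q)).

Definition even_zeta i (q : R) : R :=
  expR ((1 + x i) * zeta_odd i.-1 / 2) * Num.sqrt (2 * q * level i / n%:R).

Definition even_theta (y : 'I_n -> R) i (p : R * R) : R :=
  theta_hat y (even_alpha i p.2) p.1.

Definition odd_q (y : 'I_n -> R) i (theta : R) : R := st_q (odd_stage c x eps y i theta).

Lemma even_zeta_gt0 i q : (1 <= i <= 2 * k)%N -> 0 < q -> 0 < even_zeta i q.
Proof.
move=> ik q0; rewrite mulr_gt0 ?expR_gt0// sqrtr_gt0 divr_gt0//.
by rewrite !mulr_gt0// level_gt0.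
Qed.

Lemma even_alpha_gt0 i q : (1 <= i <= 2 * k)%N -> 0 < q -> 0 < even_alpha i q.
Proof.
move=> ik q0; rewrite mulr_gt0 ?expR_gt0// sqrtr_gt0 divr_gt0 ?mulr_gt0//.
exact: level_gt0.
Qed.

Context (m v : R).

Local Notation mu := (second_moment m v).

(** The scale $\alpha$ balances the bias term $\alpha\mu/2$, where $\mu$ is replaced by
    its upper confidence bound, and the deviation term, in $1/\alpha$. *)
Lemma even_balance i q theta : (1 <= i <= 2 * k)%N -> 0 < q ->
  mu theta <= q * expR ((1 + x i) * zeta_odd i.-1) ->
  even_alpha i q ^+ 2 * mu theta / 2 + level i / n%:R <= even_alpha i q * even_zeta i q.
Proof.
move=> ik q0 muq; have L0 := level_gt0 ik.
set E := (1 + x i) * zeta_odd i.-1 in muq *.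
have -> : even_alpha i q * even_zeta i q = 2 * level i / n%:R.
  rewrite /even_alpha /even_zeta -/E mulrACA -expRD addNr expR0 mul1r.
  rewrite -sqrtrM ?divr_ge0 ?mulr_ge0 ?ltW//.
  have -> : 2 * level i / (n%:R * q) * (2 * q * level i / n%:R) = (2 * level i / n%:R) ^+ 2.
    by field; rewrite !gt_eqF.
  by rewrite sqrtr_sqr ger0_norm// divr_ge0 ?mulr_ge0 ?ltW.
have -> : even_alpha i q ^+ 2 = expR (- E) * (2 * level i / (n%:R * q)).
  rewrite exprMn sqr_sqrtr ?divr_ge0 ?mulr_ge0 ?ltW// -expRM_natr.
  by congr (expR _ * _); rewrite -/E; field.
have le1 : expR (- E) * (2 * level i / (n%:R * q)) * mu theta / 2 <= level i / n%:R.
  have -> : level i / n%:R = expR (- E) * (2 * level i / (n%:R * q)) * (q * expR E) / 2.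
    by rewrite expRN; field; rewrite !gt_eqF ?expR_gt0.
  rewrite ler_pM2r ?invr_gt0// ler_pM2l//.
  by rewrite mulr_gt0 ?expR_gt0// divr_gt0 ?mulr_gt0.
have : 2 * level i / n%:R = level i / n%:R + level i / n%:R.
  by rewrite -mulrA mulr2n mulrDl !mul1r.
lra.
Qed.

Local Notation S := (n.-tuple R).

(** Stages are numbered from 1 and parameters from 0: the parameter [j] is the one of
    stage [j.+1], and it is turned into the next one by the variable of index
    [j.+2]. *)
Definition data_step (j : nat) (o : (S * (R * R)) * R) : R * R :=
  let y := tnth o.1.1 in let p := o.1.2 in let u := o.2 in
  if odd j then
    (even_theta y j.+1 p + even_zeta j.+1 p.2 * x j.+2 * u, p.2)
  else (p.1, odd_q y j.+1 p.1 * expR (x j.+2 * zeta_odd j.+1 * u)).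

(** The perturbation around the true mean, or around the true second moment, wide
    enough to cover [data_step] on the good event. *)
Definition ideal_step (j : nat) (o : (R * R) * R) : R * R :=
  let p := o.1 in let u := o.2 in
  if odd j then (m + (1 + x j.+2) * even_zeta j.+1 p.2 * u, p.2)
  else (p.1, expR (ln (mu p.1) + (1 + x j.+2) * zeta_odd j.+1 * u)).

Definition good_stage (j : nat) : set (S * (R * R)) :=
  [set o | let y := tnth o.1 in let p := o.2 in
    if odd j then 0 < p.2 /\ `|m - even_theta y j.+1 p| < even_zeta j.+1 p.2
    else let Q t := Qfun y p.1 (delta j.+1) (t / mu p.1) in
      let z := - ((c - 1) * delta j.+1 ^+ 2) in
      Q (delta j.+1 * (1 - h j.+1)) < z /\ z < Q (delta j.+1)].

(** What an even stage requires from its parameter; an odd stage accepts any. *)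
Definition ideal_dom (j : nat) : set (R * R) :=
  [set p | odd j ->
    0 < p.2 /\ mu p.1 <= p.2 * expR ((1 + x j.+1) * zeta_odd j)].

Hypothesis c2 : 2 <= c.

Lemma delta_gt0 i : (1 <= i <= 2 * k)%N -> 0 < delta i.
Proof.
move=> ik; rewrite sqrtr_gt0 divr_gt0 ?mulr_gt0 ?level_gt0//.
by move: c2; lra.
Qed.

Lemma level_delta i : (1 <= i <= 2 * k)%N ->
  level i = n%:R * ((c - 1) * delta i ^+ 2 / 2).
Proof.
move=> ik; have c1 : 0 < c - 1 by move: c2; lra.
rewrite sqr_sqrtr; last by rewrite divr_ge0 ?mulr_ge0 ?ltW ?level_gt0.
by field; rewrite !gt_eqF.
Qed.

Hypothesis hdelta : forall i, (1 <= i <= k)%N ->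
  delta (2 * i).-1 <= (2 * Num.sqrt (c * (c - 1)) - (c - 1))^-1.

Lemma odd_delta_le j : ~~ odd j -> (j < 2 * k)%N ->
  delta j.+1 <= (2 * Num.sqrt (c * (c - 1)) - (c - 1))^-1.
Proof.
move=> oj jk; have -> : j.+1 = (2 * j./2.+1).-1 by clear -oj; lia.
by apply: hdelta; clear -oj jk; lia.
Qed.

Lemma odd_index_delta_le1 j : ~~ odd j -> (j < 2 * k)%N -> delta j.+1 <= 1.
Proof. by move=> oj jk; apply: (odd_delta_le1 c2 (delta_gt0 _) (odd_delta_le _ _)). Qed.

Hypothesis hzeta : forall i, (1 <= i <= k)%N -> h (2 * i).-1 < 1.

Lemma odd_index_h j : ~~ odd j -> (j < 2 * k)%N -> 0 < h j.+1 < 1.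
Proof.
move=> oj jk; rewrite /h (odd_h_gt0 c2 (delta_gt0 _))//=.
by rewrite (_ : j.+1 = (2 * j./2.+1).-1); [apply: hzeta; lia|lia].
Qed.

Lemma zeta_odd_gt0 j : ~~ odd j -> (j < 2 * k)%N -> 0 < zeta_odd j.+1.
Proof.
move=> oj jk; have /andP[h0 h1] := odd_index_h oj jk.
rewrite /zeta_odd -/(h _) -mulrN mulr_gt0//.
by rewrite oppr_gt0 ln_lt0//; apply/andP; split; lra.
Qed.

Hypothesis hv0 : 0 < v.

Lemma good_odd_q j y p : ~~ odd j -> (j < 2 * k)%N -> good_stage j (y, p) ->
  0 < odd_q (tnth y) j.+1 p.1 /\
  `|ln (odd_q (tnth y) j.+1 p.1) - ln (mu p.1)| <= zeta_odd j.+1.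
Proof.
move=> oj jk; rewrite /good_stage /= (negbTE oj) => -[Qa Qb].
have /andP[h0 h1] := odd_index_h oj jk.
have d0 : 0 < delta j.+1 by apply: delta_gt0.
have mu0 : 0 < mu p.1 by exact: second_moment_gt0.
apply: (ratio_log_bound d0 h0 h1 mu0).
apply: Qinv_bracket => //; first exact: odd_index_delta_le1.
- by rewrite divr_ge0 ?mulr_ge0 ?ltW//; lra.
- by rewrite ler_pM2r ?invr_gt0// ler_piMr ?ltW//; lra.
Qed.

Lemma ideal_dom_step j p u : (j.+1 < 2 * k)%N -> ideal_dom j p -> -1 <= u <= 1 ->
  ideal_dom j.+1 (ideal_step j (p, u)).
Proof.
move=> jk dp /andP[u1 _]; rewrite /ideal_dom /ideal_step /= => oj.
rewrite (negbTE oj)/= expR_gt0; split=> //.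
have mu0 : 0 < mu p.1 by exact: second_moment_gt0.
rewrite -expRD -[leLHS](lnK (mu0 : _ \in Num.pos)) ler_expR.
have z0 : 0 < zeta_odd j.+1 by apply: zeta_odd_gt0 => //; lia.
have x0 : 0 < x j.+2 by apply: hx; lia.
have : 0 <= (1 + x j.+2) * zeta_odd j.+1 * (1 + u) by rewrite !mulr_ge0//; lra.
lra.
Qed.

(** One perturbation costs the factor $1 + 1/x$: on the good event the centre of
    the actual perturbation is at distance at most [zeta] from the deterministic
    centre of the ideal one, whose range is $(1+x)/x$ times as wide. *)
Lemma data_step_widen j (z : S * (R * R)) (g : R * R -> \bar R) :
  (j.+1 < 2 * k)%N -> good_stage j z -> measurable_fun setT g -> (forall p, (0 <= g p)%E) ->
  (\int[uniform11 R]_u g (data_step j (z, u)) <=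
   (1 + (x j.+2)^-1)%:E * \int[uniform11 R]_u g (ideal_step j (z.2, u)))%E.
Proof.
case: z => y p jk gz mg g0; have x0 : 0 < x j.+2 by apply: hx; lia.
have [oj|oj] := boolP (odd j); last first.
  have [q0 qmu] := good_odd_q oj (ltnW jk) gz.
  have z0 : 0 < zeta_odd j.+1 by apply: zeta_odd_gt0 => //; lia.
  rewrite /data_step /ideal_step /= (negbTE oj).
  pose G t := g (p.1, expR t).
  have mG : measurable_fun setT G.
    by apply: measurableT_comp => //; exact: measurable_fun_pair.
  have := @integral_uniform_widen R (ln (odd_q (tnth y) j.+1 p.1))
    (x j.+2 * zeta_odd j.+1) (ln (mu p.1)) ((1 + x j.+2) * zeta_odd j.+1) G _ _ mG _.
  have -> : (1 + x j.+2) * zeta_odd j.+1 / (x j.+2 * zeta_odd j.+1) = 1 + (x j.+2)^-1.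
    by field; rewrite !gt_eqF.
  rewrite (eq_integral (fun u => g (p.1, odd_q (tnth y) j.+1 p.1 *
    expR (x j.+2 * zeta_odd j.+1 * u)))); last first.
    by move=> u _; rewrite /G expRD lnK.
  by apply; [rewrite mulr_gt0|lra|move=> u; exact: g0].
move: gz; rewrite /good_stage /= oj => -[q0 tz].
have z0 : 0 < even_zeta j.+1 p.2 by apply: even_zeta_gt0 => //; lia.
rewrite /data_step /ideal_step /= oj.
pose G t := g (t, p.2).
have mG : measurable_fun setT G.
    by apply: measurableT_comp => //; exact: measurable_fun_pair.
have := @integral_uniform_widen R (even_theta (tnth y) j.+1 p)
  (even_zeta j.+1 p.2 * x j.+2) m ((1 + x j.+2) * even_zeta j.+1 p.2) G _ _ mG _.
have -> : (1 + x j.+2) * even_zeta j.+1 p.2 / (even_zeta j.+1 p.2 * x j.+2) =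
    1 + (x j.+2)^-1.
  by field; rewrite !gt_eqF.
by apply; [rewrite mulr_gt0|rewrite distrC; lra|move=> u; exact: g0].
Qed.

Section Measurability.
Context dO (O : measurableType dO) (y : O -> 'I_n -> R).
Hypothesis my : forall i, measurable_fun setT (y ^~ i).

Lemma measurable_even_zeta i (q : O -> R) :
  measurable_fun setT q -> measurable_fun setT (fun o => even_zeta i (q o)).
Proof.
move=> mq; apply: measurable_funM => //; apply: (measurableT_comp (@measurable_sqrt R)).
by apply: measurable_funM => //; apply: measurable_funM => //; exact: measurable_funM.
Qed.

Lemma measurable_even_theta i (p : O -> R * R) : measurable_fun setT p ->
  measurable_fun setT (fun o => even_theta (y o) i (p o)).
Proof.
move=> mp; have mp1 : measurable_fun setT (fun o => (p o).1) by exact: measurableT_comp.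
have mp2 : measurable_fun setT (fun o => (p o).2) by exact: measurableT_comp.
apply: measurable_theta_hat => //; apply: measurable_funM => //.
apply: (measurableT_comp (@measurable_sqrt R)); apply: measurable_funM => //.
by apply: (measurableT_comp (@measurable_inv R)); exact: measurable_funM.
Qed.

Lemma measurable_odd_q i (theta : O -> R) : delta i <= 1 ->
  measurable_fun setT theta -> measurable_fun setT (fun o => odd_q (y o) i (theta o)).
Proof.
move=> d1 mt; apply: measurable_funM => //.
by apply: (measurableT_comp (@measurable_inv R)); exact: measurable_Qinv.
Qed.

Lemma measurable_second_moment (theta : O -> R) :
  measurable_fun setT theta -> measurable_fun setT (fun o => mu (theta o)).
Proof.
move=> mt; apply: measurable_funD => //; apply: measurable_funX.
exact: measurable_funB.
Qed.

End Measurability.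

Lemma measurable_data_step j : (j.+1 < 2 * k)%N -> measurable_fun setT (data_step j).
Proof.
move=> jk.
have my i : measurable_fun setT (fun o : (S * (R * R)) * R => tnth o.1.1 i).
  by apply: (measurableT_comp (measurable_tnth i)); exact: measurableT_comp.
have mp : measurable_fun setT (fun o : (S * (R * R)) * R => o.1.2).
  exact: measurableT_comp.
have mp1 : measurable_fun setT (fun o : (S * (R * R)) * R => o.1.2.1).
  exact: measurableT_comp.
have mp2 : measurable_fun setT (fun o : (S * (R * R)) * R => o.1.2.2).
  exact: measurableT_comp.
rewrite /data_step; have [oj|oj] := boolP (odd j).
  apply: measurable_fun_pair => //; apply: measurable_funD.
    exact: measurable_even_theta.
  by apply: measurable_funM => //; apply: measurable_funM => //; exact: measurable_even_zeta.
apply: measurable_fun_pair => //; apply: measurable_funM.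
  by apply: measurable_odd_q => //; apply: odd_index_delta_le1 => //; exact: ltnW.
by apply: measurableT_comp => //; exact: measurable_funM.
Qed.

Lemma measurable_ideal_step j : measurable_fun setT (ideal_step j).
Proof.
have mp1 : measurable_fun setT (fun o : (R * R) * R => o.1.1) by exact: measurableT_comp.
have mp2 : measurable_fun setT (fun o : (R * R) * R => o.1.2) by exact: measurableT_comp.
rewrite /ideal_step; case: (odd j).
  apply: measurable_fun_pair => //; apply: measurable_funD => //.
  by apply: measurable_funM => //; apply: measurable_funM => //; exact: measurable_even_zeta.
apply: measurable_fun_pair => //; apply: measurableT_comp => //.
apply: measurable_funD; last exact: measurable_funM.
by apply: (measurableT_comp (@measurable_ln R)); exact: measurable_second_moment.
Qed.

Lemma measurable_good_stage j : measurable (good_stage j).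
Proof.
have my i : measurable_fun setT (fun o : S * (R * R) => tnth o.1 i).
  exact: (measurableT_comp (measurable_tnth i)).
have mp : measurable_fun setT (fun o : S * (R * R) => o.2) by exact: measurable_snd.
have mp1 : measurable_fun setT (fun o : S * (R * R) => o.2.1) by exact: measurableT_comp.
have mp2 : measurable_fun setT (fun o : S * (R * R) => o.2.2) by exact: measurableT_comp.
have mlt (f g : S * (R * R) -> R) : measurable_fun setT f -> measurable_fun setT g ->
    measurable [set o | f o < g o].
  move=> mf mg; have -> : [set o | f o < g o] = ~` [set o | g o <= f o].
    by apply/seteqP; split=> o /=; rewrite ltNge => /negP.
  by apply: measurableC; rewrite -[X in measurable X]setTI; apply: measurable_fun_le.
rewrite /good_stage; case: (odd j) => /=.
  apply: measurableI; apply: mlt => //; last exact: measurable_even_zeta.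
  apply: measurableT_comp => //; apply: measurable_funB => //.
  exact: measurable_even_theta.
have mQ t : measurable_fun setT (fun o : S * (R * R) =>
    Qfun (tnth o.1) o.2.1 (delta j.+1) (t / mu o.2.1)).
  apply: measurable_Qfun => //; apply: measurable_funM => //.
  by apply: (measurableT_comp (@measurable_inv R)); exact: measurable_second_moment.
by apply: measurableI; apply: mlt.
Qed.

End Stages.

(** * Failure probability of one stage *)

Section BadStage.
Context d (T : measurableType d) (R : realType) (P : probability T R).
Context (n k : nat) (hn : (0 < n)%N) (Y : {RV P >-> R}) (m v c : R).
Context (hm : ('E_P[Y] = m%:E)%E) (hv : ('V_P[Y] = v%:E)%E) (hv0 : 0 < v)
  (hc : uniform_kurtosis P Y = c%:E).
Context (I : finType) (X : I -> {RV P >-> R}) (hX : mutually_independent X).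
Context (e : 'I_n -> I) (e_inj : injective e).
Hypothesis XY : forall j, identically_distributed (X (e j)) Y.
Context (x eps : nat -> R).
Hypothesis hx : forall i, (1 <= i <= 2 * k)%N -> 0 < x i.
Hypothesis heps : forall i, (1 <= i <= 2 * k)%N -> 0 < eps i < 1.
Hypothesis hdelta : forall i, (1 <= i <= k)%N ->
  delta n c x eps (2 * i).-1 <= (2 * Num.sqrt (c * (c - 1)) - (c - 1))^-1.

Let c2 : 2 <= c. Proof. exact: (uniform_kurtosis_ge2 hm hv hv0 hc). Qed.

(** Each stage fails if one of two one-sided deviation bounds does. *)
Lemma bad_stage_le j p : (j < 2 * k)%N -> ideal_dom x eps n c m v j p ->
  (P [set w | ~ good_stage x eps c m v j ([tuple X (e i) w | i < n], p)] <=
   (2 * expR (- level x eps j.+1))%:E)%E.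
Proof.
move=> jk dp; have j1k : (1 <= j.+1 <= 2 * k)%N by [].
have yE w : tnth [tuple X (e i) w | i < n] = fun i => X (e i) w.
  by apply/funext => i; rewrite tnth_mktuple.
have my i : measurable_fun setT (fun w => X (e i) w) by exact: measurable_funPT.
rewrite mulr_natl mulr2n.
have [oj|oj] := boolP (odd j).
  have [q0 muq] := dp oj.
  have a0 : 0 < even_alpha x eps n c j.+1 p.2 by apply: (even_alpha_gt0 hx heps hn).
  have bal : even_alpha x eps n c j.+1 p.2 ^+ 2 * second_moment m v p.1 / 2 +
      level x eps j.+1 / n%:R <=
      even_alpha x eps n c j.+1 p.2 * even_zeta x eps n c j.+1 p.2.
    exact: (even_balance hx heps hn).
  have tail sg := @theta_hat_tail _ _ _ P _ _ hX _ hn e e_inj Y m v hm hv XY sg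
    p.1 _ _ _ a0 bal.
  apply: le_trans (measure_setU_le _ _ (tail false) (tail true)).
  - rewrite le_eqVlt; apply/orP; left; apply/eqP; congr (P _).
    apply/seteqP; split=> w; rewrite /good_stage /= oj yE /even_theta;
      rewrite expr0 expr1 mul1r mulN1r.
      move=> ng; apply: contrapT => /not_orP[/negP h1 /negP h2]; apply: ng; split=> //.
      by rewrite -!ltNge in h1 h2; rewrite ltr_norml; apply/andP; split; lra.
    rewrite ltr_norml => h [_ /andP[h1 h2]]; lra.
  - rewrite -[X in measurable X]setTI; apply: measurable_fun_le => //.
    apply: measurable_funM => //; apply: measurable_funB => //.
    exact: measurable_theta_hat.
  - rewrite -[X in measurable X]setTI; apply: measurable_fun_le => //.
    apply: measurable_funM => //; apply: measurable_funB => //.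
    exact: measurable_theta_hat.
have d0 := delta_gt0 hx heps hn c2 j1k.
have dle := odd_delta_le hdelta oj jk.
have LE := level_delta hx heps hn c2 j1k.
have root := odd_h_root c2 d0 dle.
have tail sg t z := @Qfun_tail _ _ _ P _ _ hX _ hn e e_inj Y m v c hm hv hv0 hc XY sg
  p.1 (delta n c x eps j.+1) t (level x eps j.+1) z.
set dl := delta n c x eps j.+1 in d0 dle LE root tail *.
set hh := hfun _ _ in root *.
have t1 := tail false (dl * (1 - hh)) (- ((c - 1) * dl ^+ 2)).
have t2 := tail true dl ((c - 1) * dl ^+ 2).
apply: le_trans (measure_setU_le _ _ (t1 _) (t2 _)).
- rewrite le_eqVlt; apply/orP; left; apply/eqP; congr (P _).
  apply/seteqP; split=> w; rewrite /good_stage /= (negbTE oj) yE -/dl -/hh;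
    rewrite expr0 expr1 mul1r mulN1r.
    move=> ng; apply: contrapT => /not_orP[/negP h1 /negP h2]; apply: ng.
    by rewrite -!ltNge in h1 h2; split=> //; lra.
  by move=> h [h1 h2]; case: h; [rewrite leNgt h1|move=> h; lra].
- by rewrite -[X in measurable X]setTI; apply: measurable_fun_le => //;
    apply: measurable_funM => //; exact: measurable_Qfun.
- by rewrite -[X in measurable X]setTI; apply: measurable_fun_le => //;
    apply: measurable_funM => //; exact: measurable_Qfun.
- by rewrite expr0 mul1r LE -root; ring.
- by rewrite expr1 LE; field.
Qed.

End BadStage.

(** * Inequalities on a path without failure *)

Section GoodPath.
Context (R : realType) (k : nat) (x eps : nat -> R).
Hypothesis hx : forall i, (1 <= i <= 2 * k)%N -> 0 < x i.
Hypothesis heps : forall i, (1 <= i <= 2 * k)%N -> 0 < eps i < 1.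
Context (n : nat) (hn : (0 < n)%N) (c : R) (c2 : 2 <= c).
Hypothesis hdelta : forall i, (1 <= i <= k)%N ->
  delta n c x eps (2 * i).-1 <= (2 * Num.sqrt (c * (c - 1)) - (c - 1))^-1.
Hypothesis hzeta : forall i, (1 <= i <= k)%N ->
  hfun (c / (c - 1)) ((c - 1) * delta n c x eps (2 * i).-1) < 1.
Context (m v : R) (hv0 : 0 < v) (theta1 : R) (y : n.-tuple R) (u : nat -> R).

Local Notation mu := (second_moment m v).
Local Notation level := (level x eps).
Local Notation st := (stage c x eps theta1 (tnth y) u).

Fixpoint path_param j : R * R :=
  if j is i.+1 then data_step x eps c i ((y, path_param i), u i.+2) else (theta1, 0).

Lemma stage_path_param j : st j.+1 =
  if odd j then Stage (even_theta x eps c (tnth y) j.+1 (path_param j)) (path_param j).2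
                  (even_zeta x eps n c j.+1 (path_param j).2)
  else odd_stage c x eps (tnth y) j.+1 (path_param j).1.
Proof.
elim: j => [//|j IHj].
rewrite -[LHS]/(let s := st j.+1 in if odd j.+2
    then odd_stage c x eps (tnth y) j.+2 (st_theta s + st_zeta s * x j.+2 * u j.+2)
    else even_stage x eps (tnth y) (u j.+2) j.+2 s).
rewrite IHj /= /data_step negbK.
by case: (odd j).
Qed.

Hypothesis hu : forall i, (2 <= i <= 2 * k)%N -> -1 <= u i <= 1.
Hypothesis path_good : forall j, (j < 2 * k)%N ->
  good_stage x eps c m v j (y, path_param j).

Section Pair.
Context (j : nat) (oj : ~~ odd j) (jk : (j.+1 < 2 * k)%N).

Let s1 := st j.+1.
Let s2 := st j.+2.

Let s1E : s1 = odd_stage c x eps (tnth y) j.+1 (path_param j).1.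
Proof. by rewrite /s1 stage_path_param (negbTE oj). Qed.

Lemma path_odd : [/\ 0 < st_zeta s1, 0 < st_q s1 &
  `|ln (st_q s1) - ln (mu (st_theta s1))| <= st_zeta s1].
Proof.
have jk' := ltnW jk.
have [q0 hq] := good_odd_q hx heps hn c2 hdelta hzeta hv0 oj jk' (path_good jk').
rewrite s1E.
split; [|exact: q0|exact: hq].
exact: (zeta_odd_gt0 hx heps hn c2 hzeta oj jk').
Qed.

Lemma path_odd_q_le : st_q s1 <= mu (st_theta s1) * expR (st_zeta s1).
Proof.
have [z0 q0] := path_odd; have mu0 := second_moment_gt0 m hv0 (st_theta s1).
rewrite ler_norml => /andP[_ h].
rewrite -[X in X <= _]lnK ?posrE// -[mu _]lnK ?posrE// -expRD ler_expR; lra.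
Qed.

Lemma path_odd_q_ge : mu (st_theta s1) <= expR (st_zeta s1) * st_q s1.
Proof.
have [z0 q0] := path_odd; have mu0 := second_moment_gt0 m hv0 (st_theta s1).
rewrite ler_norml => /andP[h _].
rewrite -[X in _ <= _ * X]lnK ?posrE// -[mu _]lnK ?posrE// -expRD ler_expR; lra.
Qed.

Lemma path_even : [/\ 0 < st_zeta s2 & `|m - st_theta s2| <= st_zeta s2].
Proof.
have := path_good jk; rewrite /good_stage /s2 stage_path_param /= oj => -[q0 h].
split; last exact: ltW.
by apply: (even_zeta_gt0 hx heps hn).
Qed.

Lemma path_even_zeta_le : st_zeta s2 <=
  expR ((1 + x j.+2) * st_zeta s1) * Num.sqrt (2 * mu (st_theta s1) * level j.+2 / n%:R).
Proof.
have [z0 q0 _] := path_odd; have qle := path_odd_q_le.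
have n0 : 0 < n%:R :> R by rewrite ltr0n.
have x0 : 0 < x j.+2 by apply: hx; clear -jk; lia.
have L0 : 0 < level j.+2 by apply: (level_gt0 hx heps); clear -jk; lia.
have /andP[_ u1] : -1 <= u j.+2 <= 1 by apply: hu; clear -jk; lia.
have mu0 := second_moment_gt0 m hv0 (st_theta s1).
have -> : st_zeta s2 = expR ((1 + x j.+2) * st_zeta s1 / 2) *
    Num.sqrt (2 * (st_q s1 * expR (x j.+2 * st_zeta s1 * u j.+2)) * level j.+2 / n%:R).
  rewrite /s2 stage_path_param /= oj /even_zeta /= /data_step (negbTE oj) /=.
  by rewrite s1E.
set E := (1 + x j.+2) * st_zeta s1.
have qE : st_q s1 * expR (x j.+2 * st_zeta s1 * u j.+2) <= expR E * mu (st_theta s1).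
  apply: (@le_trans _ _
    (mu (st_theta s1) * expR (st_zeta s1) * expR (x j.+2 * st_zeta s1))).
    apply: ler_pM; [exact: ltW|exact: expR_ge0|exact: qle|].
    by rewrite ler_expR ler_piMr// mulr_ge0// ltW.
  by rewrite -mulrA -expRD mulrC /E mulrDl mul1r.
have -> : expR E = expR (E / 2) * expR (E / 2) by rewrite -expRD -splitr.
rewrite -[leRHS]mulrA ler_pM2l ?expR_gt0//.
rewrite -[X in _ <= X * _]ger0_norm ?expR_ge0// -sqrtr_sqr -sqrtrM ?sqr_ge0//.
rewrite ler_sqrt; last first.
  by rewrite mulr_ge0 ?sqr_ge0// divr_ge0 ?mulr_ge0 ?ltW.
have -> : expR (E / 2) ^+ 2 = expR E by rewrite -expRM_natr divfK.
have -> : expR E * (2 * mu (st_theta s1) * level j.+2 / n%:R) =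
    2 * (expR E * mu (st_theta s1)) * level j.+2 / n%:R by ring.
by rewrite ler_pM2r ?invr_gt0// ler_pM2r// ler_pM2l.
Qed.

Lemma path_next_theta : (j.+2 < 2 * k)%N ->
  (m - st_theta (st j.+3)) ^+ 2 <= (1 + x j.+3) ^+ 2 * st_zeta s2 ^+ 2.
Proof.
move=> jk2; have [z0 h] := path_even.
have x0 : 0 < x j.+3 by apply: hx; clear -jk2; lia.
have hu3 : -1 <= u j.+3 <= 1 by apply: hu; clear -jk2; lia.
have -> : st_theta (st j.+3) = st_theta s2 + st_zeta s2 * x j.+3 * u j.+3.
  rewrite -[st j.+3]/(let s := s2 in if odd j.+3
    then odd_stage c x eps (tnth y) j.+3 (st_theta s + st_zeta s * x j.+3 * u j.+3)
    else even_stage x eps (tnth y) (u j.+3) j.+3 s).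
  by rewrite /= negbK oj.
rewrite -exprMn -[leLHS]real_normK ?num_real//.
rewrite ler_sqr ?nnegrE ?normr_ge0//; last by rewrite mulr_ge0 ?addr_ge0// ltW.
rewrite opprD addrA; apply: le_trans (ler_normB _ _) _.
rewrite mulrDl mul1r lerD// normrM ger0_norm; last by rewrite mulr_ge0// ltW.
rewrite [x _ * _]mulrC ler_piMr ?ler_norml//.
by rewrite mulr_ge0// ltW.
Qed.

End Pair.

Lemma path_zeta_odd j : ~~ odd j -> st_zeta (st j.+1) = zeta_odd n c x eps j.+1.
Proof. by move=> oj; rewrite stage_path_param (negbTE oj). Qed.

Let half_width_le i (E a b : R) : (1 <= i <= 2 * k)%N -> a <= b ->
  expR E * Num.sqrt (2 * a * level i / n%:R) <= expR E * Num.sqrt (2 * b * level i / n%:R).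
Proof.
move=> ik ab; rewrite ler_pM2l ?expR_gt0//; apply: ler_wsqrtr.
have L0 := level_gt0 hx heps ik.
by rewrite ler_pM2r ?invr_gt0 ?ltr0n// ler_pM2r// ler_pM2l.
Qed.

Lemma path_second_moment_le j : ~~ odd j -> (j.+3 < 2 * k)%N ->
  mu (st_theta (st j.+3)) <= v + (1 + x j.+3) ^+ 2 * st_zeta (st j.+2) ^+ 2.
Proof. by move=> oj jk; rewrite lerD2l path_next_theta//; clear -jk; lia. Qed.

Lemma path_zeta_bound i : (i < k)%N ->
  st_zeta (st (2 * i).+2) <= zeta_bound n c x eps m v theta1 i.+1.
Proof.
elim: i => [|i IHi] ik.
  have k2 : (1 < 2 * k)%N by clear -ik; lia.
  by have := path_even_zeta_le (j := 0) isT k2; rewrite muln0 (path_zeta_odd (j := 0)).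
have j1 : (2 * i).+3 = (2 * i.+2).-1 by clear; lia.
have j2 : (2 * i).+4 = (2 * i.+2)%N by clear; lia.
have jk : ((2 * i).+3 < 2 * k)%N by clear -ik; lia.
have oj : ~~ odd (2 * i) by clear; lia.
have oj2 : ~~ odd (2 * i).+2 by clear; lia.
rewrite (_ : (2 * i.+1).+2 = (2 * i).+4); last by clear; lia.
rewrite -[zeta_bound _ _ _ _ _ _ _ _]/(
    expR ((1 + x (2 * i.+2)) * zeta_odd n c x eps (2 * i.+2).-1) *
    Num.sqrt (2 * (v + (1 + x (2 * i.+2).-1) ^+ 2 *
                       zeta_bound n c x eps m v theta1 i.+1 ^+ 2) *
              level (2 * i.+2) / n%:R)).
rewrite -j1 -j2; have := path_even_zeta_le oj2 jk.
rewrite (path_zeta_odd oj2) => /le_trans; apply.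
apply: half_width_le; first by clear -ik; lia.
apply: le_trans (path_second_moment_le oj jk) _.
have jk1 : ((2 * i).+1 < 2 * k)%N by clear -ik; lia.
have [z0 _] := path_even oj jk1; have IH := IHi (ltnW ik).
rewrite lerD2l ler_wpM2l ?sqr_ge0// ler_sqr ?nnegrE//; first exact: ltW.
by rewrite (le_trans _ IH)// ltW.
Qed.

(** Nothing random remains on a path along which no stage fails: the bounds on one
    stage carry over to the next one because $|U_i| \le 1$. *)
Lemma good_path_bounds : (0 < k)%N ->
  [/\ forall i, (1 <= i <= k)%N ->
        `|m - st_theta (st (2 * i))| <= st_zeta (st (2 * i)) /\
        `|ln (st_q (st (2 * i).-1)) - ln (v + (m - st_theta (st (2 * i).-1)) ^+ 2)|
          <= st_zeta (st (2 * i).-1),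
      st_zeta (st 2) <= expR ((1 + x 2%N) * st_zeta (st 1)) *
        Num.sqrt (2 * (v + (m - theta1) ^+ 2) * level 2 / n%:R),
      forall i, (2 <= i <= k)%N ->
        [/\ (m - st_theta (st (2 * i).-1)) ^+ 2 <=
              (1 + x (2 * i).-1) ^+ 2 * st_zeta (st (2 * i - 2)) ^+ 2,
            st_q (st (2 * i).-1) <=
              (v + (1 + x (2 * i).-1) ^+ 2 * st_zeta (st (2 * i - 2)) ^+ 2) *
              expR (st_zeta (st (2 * i).-1)),
            st_zeta (st (2 * i)) <=
              expR ((1 + x (2 * i)%N) * st_zeta (st (2 * i).-1)) *
              Num.sqrt (2 * (v + (1 + x (2 * i).-1) ^+ 2 *
                                 st_zeta (st (2 * i - 2)) ^+ 2) *
                        level (2 * i) / n%:R),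
            expR (- st_zeta (st (2 * i).-1)) * st_q (st (2 * i).-1) -
              (1 + x (2 * i).-1) ^+ 2 * st_zeta (st (2 * i - 2)) ^+ 2 <= v &
            v <= expR (st_zeta (st (2 * i).-1)) * st_q (st (2 * i).-1)] &
      st_zeta (st (2 * k)) <= zeta_bound n c x eps m v theta1 k].
Proof.
move=> hk; split.
- case=> // i /andP[_ ik].
  have oj : ~~ odd (2 * i) by clear; lia.
  have jk : ((2 * i).+1 < 2 * k)%N by clear -ik; lia.
  rewrite (_ : (2 * i.+1).-1 = (2 * i).+1); last by clear; lia.
  rewrite (_ : (2 * i.+1)%N = (2 * i).+2); last by clear; lia.
  by have [_ ? ] := path_even oj jk; have [_ _ ?] := path_odd oj jk; split.
- have k2 : (1 < 2 * k)%N by clear -hk; lia.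
  exact: (path_even_zeta_le (j := 0) isT k2).
- case=> // -[|i] // /andP[_ ik].
  have oj : ~~ odd (2 * i) by clear; lia.
  have oj2 : ~~ odd (2 * i).+2 by clear; lia.
  have jk : ((2 * i).+3 < 2 * k)%N by clear -ik; lia.
  rewrite (_ : (2 * i.+2 - 2)%N = (2 * i).+2); last by clear; lia.
  rewrite (_ : (2 * i.+2).-1 = (2 * i).+3); last by clear; lia.
  rewrite (_ : (2 * i.+2)%N = (2 * i).+4); last by clear; lia.
  have mle := path_second_moment_le oj jk.
  have qle := path_odd_q_le oj2 jk; have qge := path_odd_q_ge oj2 jk.
  split.
  + by move: mle; rewrite lerD2l.
  + by apply: le_trans qle _; rewrite ler_pM2r ?expR_gt0.
  + apply: le_trans (path_even_zeta_le oj2 jk) _; exact: half_width_le.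
  + rewrite lerBlDr; apply: le_trans mle.
    by rewrite expRN mulrC ler_pdivrMr ?expR_gt0.
  + by apply: le_trans qge; rewrite lerDl sqr_ge0.
- case: k hk (@path_zeta_bound) => // k' _ h.
  by rewrite (_ : (2 * k'.+1)%N = (2 * k').+2); [exact: h|lia].
Qed.

End GoodPath.

(** * The confidence bounds *)

Theorem proposition5p2 (R : realType) (d : measure_display)
    (T : measurableType d) (P : probability T R)
    (n k : nat) (hn : (0 < n)%N) (hk : (0 < k)%N)
    (Y : {RV P >-> R}) (m v c : R)
    (hm : ('E_P[Y] = m%:E)%E) (hv : ('V_P[Y] = v%:E)%E) (hv0 : 0 < v)
    (hc : uniform_kurtosis P Y = c%:E)
    (Ys : 'I_n -> {RV P >-> R})
    (hYs : forall j, identically_distributed (Ys j) Y)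
    (x eps : nat -> R)
    (hx : forall i, (1 <= i <= 2 * k)%N -> 0 < x i)
    (heps : forall i, (1 <= i <= 2 * k)%N -> 0 < eps i < 1)
    (U : nat -> {RV P >-> R})
    (hU : forall i, (2 <= i <= 2 * k)%N ->
       uniformly_distributed (ltrN11 R) (U i))
    (hind : mutually_independent (@sample_and_uniforms _ _ _ P n k Ys U))
    (theta1 : R)
    (hdelta : forall i, (1 <= i <= k)%N ->
       delta n c x eps (2 * i).-1 <=
         (2 * Num.sqrt (c * (c - 1)) - (c - 1))^-1)
    (* each zeta_(2i-1) is well defined *)
    (hzeta : forall i, (1 <= i <= k)%N ->
       hfun (c / (c - 1)) ((c - 1) * delta n c x eps (2 * i).-1) < 1) :
  let st (i : nat) (w : T) :=
    stage c x eps theta1 (fun j => Ys j w) (fun j => U j w) i in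
  let theta i w := st_theta (st i w) in
  let q i w := st_q (st i w) in
  let zeta i w := st_zeta (st i w) in
  let L := level x eps in
  exists E : set T,
    [/\ measurable E,
        ((1 - 2 * \sum_(1 <= i < (2 * k).+1) eps i)%:E <= P E)%E &
        forall w, E w ->
        [/\ forall i, (1 <= i <= k)%N ->
              `|m - theta (2 * i)%N w| <= zeta (2 * i)%N w /\
              `|ln (q (2 * i).-1 w) - ln (v + (m - theta (2 * i).-1 w) ^+ 2)|
                <= zeta (2 * i).-1 w,
            zeta 2%N w <= expR ((1 + x 2%N) * zeta 1%N w) *
              Num.sqrt (2 * (v + (m - theta1) ^+ 2) * L 2%N / n%:R),
            forall i, (2 <= i <= k)%N ->
              [/\ (m - theta (2 * i).-1 w) ^+ 2 <=
                    (1 + x (2 * i).-1) ^+ 2 * zeta (2 * i - 2)%N w ^+ 2,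
                  q (2 * i).-1 w <=
                    (v + (1 + x (2 * i).-1) ^+ 2 * zeta (2 * i - 2)%N w ^+ 2) *
                    expR (zeta (2 * i).-1 w),
                  zeta (2 * i)%N w <=
                    expR ((1 + x (2 * i)%N) * zeta (2 * i).-1 w) *
                    Num.sqrt (2 * (v + (1 + x (2 * i).-1) ^+ 2 *
                                       zeta (2 * i - 2)%N w ^+ 2) *
                              L (2 * i)%N / n%:R),
                  expR (- zeta (2 * i).-1 w) * q (2 * i).-1 w -
                    (1 + x (2 * i).-1) ^+ 2 * zeta (2 * i - 2)%N w ^+ 2 <= v &
                  v <= expR (zeta (2 * i).-1 w) * q (2 * i).-1 w] &
            zeta (2 * k)%N w <= zeta_bound n c x eps m v theta1 k]].
Proof.
move=> st theta q zeta L.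
have c2 := uniform_kurtosis_ge2 hm hv hv0 hc.
have NE : (2 * k).-1.+1 = (2 * k)%N by clear -hk; lia.
have ltN j : (j < (2 * k).-1)%N -> (j.+1 < 2 * k)%N by clear; lia.
have hU' j : (j < (2 * k).-1)%N -> uniformly_distributed (ltrN11 R) (U j.+2).
  by move=> jN; apply: hU; clear -jN; lia.
have bad_le j p : (j <= (2 * k).-1)%N -> ideal_dom x eps n c m v j p ->
    (P [set w | ~ good_stage x eps c m v j (sample Ys w, p)] <=
     (2 * expR (- level x eps j.+1))%:E)%E.
  move=> jN; have jk : (j < 2 * k)%N by clear -jN hk; lia.
  exact: (bad_stage_le hn hm hv hv0 hc hind (e := inl) inl_inj hYs hx heps hdelta jk).
have := @good_until_ge _ _ _ P n (2 * k).-1 Ys (fun j => U j.+2) hind hU' _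
  (R * R)%type (theta1, 0) (data_step x eps c) (ideal_step x eps n c m v)
  (good_stage x eps c m v) (ideal_dom x eps n c m v)
  (fun j => 1 + (x j.+2)^-1) (fun j => 2 * expR (- level x eps j.+1)).
have [E0 [mE0 PE0 hE0]] := uniforms_in_range hU'.
case/(_ _ _ _ _ _ _ _ bad_le (2 * \sum_(1 <= i < (2 * k).+1) eps i)).
- by move=> j /ltN; exact: measurable_data_step.
- exact: measurable_ideal_step.
- exact: measurable_good_stage.
- by move=> j jN; rewrite addr_ge0// invr_ge0 ltW// hx//; clear -jN; lia.
- by move=> j z g /ltN; exact: (data_step_widen hx heps hn c2 hdelta hzeta hv0).
- by move=> j p u /ltN; exact: (ideal_dom_step hx heps hn c2 hzeta hv0).
- by [].
- rewrite NE big_add1/= big_mkord mulr_sumr; apply: ler_sum => j _.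
  by rewrite (prod_ratio_level hx heps).
move=> mG PG; set G := good_until _ _ _ _ _ _ in mG PG.
exists (G `&` E0); split; first exact: measurableI.
  by rewrite probability_setI1.
move=> w [Gw Ew].
have yE : tnth (sample Ys w) = fun j => Ys j w.
  by apply/funext => j; rewrite tnth_mktuple.
have hu i : (2 <= i <= 2 * k)%N -> -1 <= U i w <= 1.
  by case: i => // -[|i] // ik; apply: (hE0 w i Ew); clear -ik; lia.
have pathE j : path_param x eps c theta1 (sample Ys w) (fun j => U j w) j =
    @param _ _ _ _ _ Ys (fun j => U j.+2) _ (R * R)%type (theta1, 0)
      (data_step x eps c) j w.
  by elim: j => //= j ->.
have path_good j : (j < 2 * k)%N -> good_stage x eps c m v j
    (sample Ys w, path_param x eps c theta1 (sample Ys w) (fun j => U j w) j).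
  by move=> jk; rewrite pathE; apply: Gw; rewrite NE.
have := good_path_bounds hx heps hn c2 hdelta hzeta hv0 hu path_good hk.
by rewrite yE.
Qed.
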